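(* For each integer $n$ with $2\le n\le 7$, the congruence two subgroup $\Gamma^n_2$ of $\Gamma^n=PO_{n,1}\mathbb{Z}$ is a hyperbolic Coxeter group with Coxeter polytope the right-angled polytope $P^n$. That is, $P^n$ is a right-angled hyperbolic polytope, $P^n$ is a fundamental polytope for the action of $\Gamma^n_2$ on $H^n$, and $\Gamma^n_2$ is the group generated by the reflections in the sides of $P^n$.
   Context: Work in $\mathbb{R}^{n+1}$ with the Lorentzian inner product $\langle x,y\rangle=x_1y_1+\dots+x_ny_n-x_{n+1}y_{n+1}$ and the hyperboloid model $H^n=\{x\in\mathbb{R}^{n+1}:\langle x,x\rangle=-1,\ x_{n+1}>0\}$; isometries of $H^n$ are the positive Lorentzian $(n+1)\times(n+1)$ matrices (those preserving $\langle\cdot,\cdot\rangle$ and the sign of the last coordinate on time-like vectors). $\Gamma^n=PO_{n,1}\mathbb{Z}$ denotes the group of positive Lorentzian $(n+1)\times(n+1)$ matrices with integer entries, and $\Gamma^n_2$ is its subgroup of matrices congruent to the identity matrix modulo $2$. A polytope in $H^n$ is a convex polyhedron with finitely many sides and finite volume (equivalently, the convex hull of finitely many actual and ideal vertices); it is right-angled if all dihedral angles between adjacent sides are $0$ or $\pi/2$. Let $\Delta^n$ be the simplex $\Delta^n=\{x\in H^n: x_1\ge x_2\ge\dots\ge x_n\ge 0,\ x_1+x_2+x_3\le x_{n+1}\}$ for $n\ge 3$, and $\Delta^2=\{x\in H^2: x_1\ge x_2\ge 0,\ x_1+x_2\le x_3\}$ (its vertices are represented by $e_1+e_{n+1}$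 (ideal), $e_1+e_2+2e_{n+1}$, $e_1+\dots+e_k+3e_{n+1}$ for $3\le k\le n$, and $e_{n+1}$). For $n\ge3$ let $\Sigma^n$ be the finite group generated by the coordinate transpositions $x_i\leftrightarrow x_{i+1}$ ($1\le i\le n-1$) and the reflection $x\mapsto x-\langle x,w\rangle w$ with $w=e_1+e_2+e_3+e_{n+1}$ (i.e. the reflections in all sides of $\Delta^n$ except the side in $x_n=0$); let $\Sigma^2$ be the group of order $2$ generated by $x_1\leftrightarrow x_2$. Define $P^n=\bigcup_{\gamma\in\Sigma^n}\gamma(\Delta^n)$. *)

(* Defs.v *)
From HB Require Import structures.
From mathcomp Require Import all_boot all_order all_algebra.
From mathcomp Require Import all_classical all_reals all_analysis.
Set Implicit Arguments. Unset Strict Implicit. Unset Printing Implicit Defensive.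
Import Order.TTheory GRing.Theory Num.Theory.
Local Open Scope ring_scope.
Local Open Scope classical_set_scope.

(* Points of R^{n+1} are column vectors 'cV[R]_(n.+1); coordinate x_k (1<=k<=n+1)
   is the entry with index k-1; the time coordinate x_{n+1} is index ord_max. *)
Notation vec R n := 'cV[R]_(n.+1).
Notation mat R n := 'M[R]_(n.+1).

Section Hyp.
Variables (R : realType) (n : nat).

Definition coord (x : vec R n) (k : nat) : R := x (inord k.-1) 0.

Definition lor (x y : vec R n) : R :=
  \sum_(i < n.+1) (if i == ord_max then - (x i 0 * y i 0) else x i 0 * y i 0).

Definition Hn : set (vec R n) := [set x | lor x x = -1 /\ 0 < x ord_max 0].

Definition evec (k : nat) : vec R n := \col_(i < n.+1) (if i == inord k.-1 then 1 else 0).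

(* the reflection x |-> x - 2 <x,w>/<w,w> w in the hyperplane orthogonal to w *)
Definition refl (w : vec R n) : mat R n :=
  1%:M - (2 / lor w w) *: (w *m (\row_(j < n.+1)
     (if j == ord_max then - w j 0 else w j 0))).

Definition lorentzian (A : mat R n) : Prop :=
  forall x y : vec R n, lor (A *m x) (A *m y) = lor x y.
Definition positive (A : mat R n) : Prop :=
  forall x : vec R n, lor x x < 0 -> 0 < x ord_max 0 -> 0 < (A *m x) ord_max 0.

Definition Gamma : set (mat R n) :=
  [set A | lorentzian A /\ positive A /\ forall i j, A i j \is a Num.int].
Definition Gamma2 : set (mat R n) :=
  [set A | Gamma A /\ forall i j, ((A i j - (i == j)%:R) / 2) \is a Num.int].

Definition gen (S : set (mat R n)) : set (mat R n) :=
  [set A | exists s : seq (mat R n),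
     (forall B, B \in s -> S B \/ exists C, S C /\ B = invmx C) /\
     A = \prod_(B <- s) B].

Definition Delta : set (vec R n) :=
  [set x | Hn x /\
     (forall k, (1 <= k < n)%N -> coord x k.+1 <= coord x k) /\
     0 <= coord x n /\
     (if (3 <= n)%N then coord x 1 + coord x 2 + coord x 3 <= coord x n.+1
      else coord x 1 + coord x 2 <= coord x n.+1)].

Definition wvec : vec R n := evec 1 + evec 2 + evec 3 + evec n.+1.

Definition Sigma_gens : set (mat R n) :=
  [set A | (exists i, (1 <= i < n)%N /\
               A = tperm_mx (inord i.-1 : 'I_n.+1) (inord i)) \/
           ((3 <= n)%N /\ A = refl wvec)].
Definition Sigma : set (mat R n) := gen Sigma_gens.

Definition Pn : set (vec R n) :=
  [set y | exists A, Sigma A /\ exists x, Delta x /\ y = A *m x].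

(* hyperbolic convex hull of finitely many actual (time-like) and ideal
   (light-like) vertices, represented by future vectors *)
Definition hull (V : seq (vec R n)) : set (vec R n) :=
  [set x | Hn x /\ exists c : 'I_(size V) -> R,
     (forall i, 0 <= c i) /\ x = \sum_(i < size V) c i *: V`_i].

(* P is a polytope (convex polyhedron with finitely many sides and finite
   volume, the latter in the form: convex hull of finitely many actual and ideal
   vertices) whose sides are the P /\ {<x,e> = 0}, e in E, E being the list of
   unit outward normals: P = {x in H^n | <x,e> <= 0 for e in E}, P has nonempty
   interior, and each e in E gives a genuine side (a point of P lying on that
   side only). *)
Definition polytope_with_sides (P : set (vec R n)) (E : seq (vec R n)) : Prop :=
  [/\ forall e, e \in E -> lor e e = 1,
      P = [set x | Hn x /\ forall e, e \in E -> lor x e <= 0],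
      exists x, Hn x /\ forall e, e \in E -> lor x e < 0,
      forall e, e \in E -> exists x, P x /\ lor x e = 0 /\
                  forall f, f \in E -> f != e -> lor x f < 0
    & exists V : seq (vec R n),
        (forall v, v \in V -> lor v v <= 0 /\ 0 < v ord_max 0) /\ P = hull V].

(* sides with normals e, f of P are adjacent: they meet in a ridge, i.e. there
   is an actual or ideal point of (the closure of) P lying on exactly these two
   sides *)
Definition adjacent (E : seq (vec R n)) (e f : vec R n) : Prop :=
  exists p : vec R n, lor p p <= 0 /\ 0 < p ord_max 0 /\
    (forall g, g \in E -> lor p g <= 0) /\ lor p e = 0 /\ lor p f = 0 /\
    (forall g, g \in E -> g != e -> g != f -> lor p g < 0).

(* dihedral angle between adjacent sides with unit outward normals e, f *)
Definition dihedral_angle (e f : vec R n) : R := acos (- lor e f).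

Definition right_angled (E : seq (vec R n)) : Prop :=
  forall e f, e \in E -> f \in E -> e != f -> adjacent E e f ->
    dihedral_angle e f = 0 \/ dihedral_angle e f = pi / 2.

Definition interiorH (P : set (vec R n)) : set (vec R n) :=
  [set x | Hn x /\ exists eps : R, 0 < eps /\
     forall y, Hn y -> (forall i, `|y i 0 - x i 0| < eps) -> P y].

Definition fundamental_polytope (G : set (mat R n)) (P : set (vec R n)) : Prop :=
  (forall A, G A -> A != 1 -> forall x, interiorH P x -> ~ interiorH P (A *m x)) /\
  (forall y, Hn y -> exists A, G A /\ exists x, P x /\ y = A *m x).

End Hyp.

(* Main.v *)
Require Import Defs.
From HB Require Import structures.
From mathcomp Require Import all_boot all_order all_algebra.
From mathcomp Require Import all_classical all_reals all_analysis.
From mathcomp Require Import perm ring lra zify.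
Import Order.TTheory GRing.Theory Num.Theory.
Local Open Scope ring_scope.
Local Open Scope classical_set_scope.
Set Implicit Arguments. Unset Strict Implicit. Unset Printing Implicit Defensive.

(** The vector c = e_1 + ... + e_n + 3 e_{n+1} is fixed by Sigma, is time-like
    for n <= 8, and the side normals of P are exactly the integral vectors e
    with <e,e> = 1 and <e,c> = -1; for n <= 7 a Cauchy-Schwarz estimate leaves
    only four shapes for them.  Since c is orthogonal to e - f, distinct
    normals satisfy <e,f> <= 0, and <e,f> <= -2 would make e + f time-like, so
    adjacent sides are orthogonal or tangent at infinity.  Choosing in a
    Sigma-orbit the point closest to an interior point of the chamber of Sigma
    shows that every time-like vector satisfying the inequalities <x,e> <= 0
    can be folded into Delta.

    For Gamma2 the point is that an integral vector y congruent to c modulo 2,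
    of the same norm as c and satisfying all <y,e> <= 0, equals c: folded into
    Delta it has odd positive decreasing entries with
    y_1 + y_2 + y_3 <= y_{n+1}, and comparing squares forces y = c.  Any other
    vector in the Gamma2-orbit of c is therefore moved closer to c by the
    reflection in some side.  This descent gives both the generation of Gamma2
    by these reflections and the fact that P is the Dirichlet domain of c. *)

(** Coordinates counted from 0, so that [co x n] is the time coordinate. *)
Local Notation co x k := (Defs.coord x k.+1).

(** * Elementary inequalities and minima *)

Lemma cauchy_schwarz_sum (R : realFieldType) (I : finType) (P : pred I)
    (a b : I -> R) :
  (\sum_(i | P i) a i * b i) ^+ 2 <=
  (\sum_(i | P i) a i ^+ 2) * (\sum_(i | P i) b i ^+ 2).
Proof.
set A := \sum_(i | P i) a i ^+ 2; set C := \sum_(i | P i) b i ^+ 2.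
set B := \sum_(i | P i) a i * b i.
have A0 : 0 <= A by apply: sumr_ge0 => i _; apply: sqr_ge0.
have C0 : 0 <= C by apply: sumr_ge0 => i _; apply: sqr_ge0.
have expand p q : \sum_(i | P i) (p * a i - q * b i) ^+ 2 =
    p ^+ 2 * A - 2 * p * q * B + q ^+ 2 * C.
  rewrite /A /B /C !mulr_sumr -sumrB -big_split /=.
  by apply: eq_bigr => i _; ring.
(* This sum of squares is [C] times the Cauchy-Schwarz defect; [C = 0] is treated apart, as then
   every [b i] vanishes. *)
have H : \sum_(i | P i) (C * a i - B * b i) ^+ 2 = C * (A * C - B ^+ 2).
  by rewrite expand; ring.
have H0 : 0 <= C * (A * C - B ^+ 2).
  by rewrite -H; apply: sumr_ge0 => i _; apply: sqr_ge0.
have [C_eq0|Cn0] := eqVneq C 0; last first.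
  have C_gt0 : 0 < C by rewrite lt_def Cn0.
  by rewrite -subr_ge0 -(pmulr_rge0 _ C_gt0).
suff -> : B = 0 by rewrite expr0n /= mulr_ge0.
rewrite /B big1 // => i Pi.
have /eqP := C_eq0; rewrite psumr_eq0 => [/allP /(_ i)|j _]; last exact: sqr_ge0.
by rewrite mem_index_enum Pi sqrf_eq0 => /(_ isT) /eqP ->; rewrite mulr0.
Qed.

Lemma seq_argmin (R : realDomainType) (T : eqType) (f : T -> R) (s : seq T) x0 :
  x0 \in s -> exists2 x, x \in s & forall y, y \in s -> f x <= f y.
Proof.
elim: s x0 => // a s IH x0 _; case: s IH => [|b s] IH.
  by exists a; rewrite ?mem_head // => y; rewrite inE => /eqP ->.
have [x xs xm] := IH b (mem_head _ _).
have [le|lt] := leP (f a) (f x).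
  exists a; rewrite ?mem_head // => y; rewrite inE => /orP[/eqP ->//|ys].
  exact: le_trans le (xm _ ys).
exists x; first by rewrite inE xs orbT.
by move=> y; rewrite inE => /orP[/eqP ->|/xm//]; apply: ltW.
Qed.

(** * Coordinates and bilinearity of the Lorentzian form *)

Section Lorentz.
Variables (R : realType) (n : nat).
Implicit Types (x y z v e : vec R n) (A B : mat R n).

Lemma coordE x (i : 'I_n.+1) : x i 0 = co x i.
Proof. by rewrite /Defs.coord /= inord_val. Qed.

Lemma coord_max x : x ord_max 0 = co x n.
Proof. exact: coordE. Qed.

Lemma coord_ext x y : (forall k, (k <= n)%N -> co x k = co y k) -> x = y.
Proof.
by move=> H; apply/colP => i; rewrite !coordE; apply: H; rewrite -ltnS.
Qed.

Lemma coordD x y k : co (x + y) k = co x k + co y k.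
Proof. by rewrite /Defs.coord mxE. Qed.
Lemma coordN x k : co (- x) k = - co x k.
Proof. by rewrite /Defs.coord mxE. Qed.
Lemma coordZ a x k : co (a *: x) k = a * co x k.
Proof. by rewrite /Defs.coord mxE. Qed.
Lemma coord0 k : co (0 : vec R n) k = 0.
Proof. by rewrite /Defs.coord mxE. Qed.
Lemma coord_sum (I : Type) (r : seq I) (P : pred I) (F : I -> vec R n) k :
  co (\sum_(i <- r | P i) F i) k = \sum_(i <- r | P i) co (F i) k.
Proof. by rewrite /Defs.coord summxE. Qed.
Definition coordL := (coordD, coordN, coordZ, coord0).

Lemma coord_evec j k : (j <= n)%N -> (k <= n)%N ->
  co (evec R n j.+1) k = (k == j)%:R.
Proof.
move=> jn kn; rewrite /Defs.coord /evec mxE /= -val_eqE /= !inordK //.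
by case: eqP.
Qed.

Lemma lorE x y :
  lor x y = \sum_(i < n) co x i * co y i - co x n * co y n.
Proof.
rewrite /lor big_ord_recr /= eqxx !coord_max; congr (_ + _).
apply: eq_bigr => i _; rewrite -val_eqE /= ifN; last by rewrite neq_ltn ltn_ord.
by rewrite !coordE.
Qed.

Lemma lorC x y : lor x y = lor y x.
Proof.
rewrite !lorE [X in _ - X]mulrC; congr (_ - _).
by apply: eq_bigr => i _; rewrite mulrC.
Qed.

Lemma lorDl x y z : lor (x + y) z = lor x z + lor y z.
Proof.
rewrite !lorE; under eq_bigr do rewrite coordD mulrDl.
by rewrite big_split coordD /=; ring.
Qed.

Lemma lorZl a x y : lor (a *: x) y = a * lor x y.
Proof.
rewrite !lorE; under eq_bigr do rewrite coordZ -mulrA.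
by rewrite -mulr_sumr coordZ; ring.
Qed.

Lemma lorNl x y : lor (- x) y = - lor x y.
Proof. by rewrite -scaleN1r lorZl mulN1r. Qed.
Lemma lor0l y : lor 0 y = 0.
Proof. by rewrite -(scale0r 0) lorZl mul0r. Qed.
Lemma lorDr x y z : lor x (y + z) = lor x y + lor x z.
Proof. by rewrite lorC lorDl !(lorC x). Qed.
Lemma lorZr a x y : lor x (a *: y) = a * lor x y.
Proof. by rewrite lorC lorZl lorC. Qed.
Lemma lorNr x y : lor x (- y) = - lor x y.
Proof. by rewrite lorC lorNl lorC. Qed.
Definition lorL := (lorDl, lorDr, lorZl, lorZr, lorNl, lorNr).

Lemma lor_suml (I : Type) (r : seq I) (P : pred I) (F : I -> vec R n) y :
  lor (\sum_(i <- r | P i) F i) y = \sum_(i <- r | P i) lor (F i) y.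
Proof.
by elim/big_rec2: _ => [|i u w _ <-]; rewrite ?lor0l // lorDl.
Qed.

Lemma coord_evec_mulmx A j : (j <= n)%N ->
  forall i, (A *m evec R n j.+1) i 0 = A i (inord j).
Proof.
move=> jn i; rewrite mxE (bigD1 (inord j)) //= big1 ?addr0.
  by rewrite mxE eqxx mulr1.
by move=> k /negPf nk; rewrite mxE nk mulr0.
Qed.

Lemma lor_evec x j : (j < n)%N -> lor x (evec R n j.+1) = co x j.
Proof.
move=> jn; rewrite lorE coord_evec // ?(ltnW jn) // (gtn_eqF jn) mulr0 subr0.
rewrite (bigD1 (Ordinal jn)) //= big1 ?addr0 => [|i].
  by rewrite coord_evec ?(ltnW jn) // eqxx mulr1.
rewrite -val_eqE /= => /negPf ni.
by rewrite coord_evec ?(ltnW jn) ?(ltnW (ltn_ord i)) // ni mulr0.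
Qed.

Lemma lor_evec_max x : lor x (evec R n n.+1) = - co x n.
Proof.
rewrite lorE coord_evec // eqxx mulr1 big1 ?sub0r // => i _.
by rewrite coord_evec ?(ltnW (ltn_ord i)) // (ltn_eqF (ltn_ord i)) mulr0.
Qed.

Lemma lor_nondeg x y : (forall z, lor x z = lor y z) -> x = y.
Proof.
move=> H; apply: coord_ext => k; rewrite leq_eqVlt => /orP[/eqP ->|kn].
  by apply: oppr_inj; rewrite -!lor_evec_max.
by rewrite -!lor_evec.
Qed.

(** * Causal vectors *)

Lemma coord_causal_le v k : lor v v <= 0 -> (k <= n)%N -> `|co v k| <= `|co v n|.
Proof.
move=> v0; rewrite leq_eqVlt => /orP[/eqP ->//|kn].
rewrite -ler_sqr ?nnegrE // !real_normK ?num_real //.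
move: v0; rewrite lorE (bigD1 (Ordinal kn)) //= => v0.
suff H : 0 <= \sum_(i < n | i != Ordinal kn) co v i * co v i.
  by rewrite !expr2; lra.
by apply: sumr_ge0 => i _; rewrite -expr2 sqr_ge0.
Qed.

(* Reverse Cauchy-Schwarz, in a weak form that avoids square roots. *)
Lemma lor_causal_timelike v y :
  lor v v <= 0 -> 0 <= co v n -> lor y y < 0 -> 0 < co y n ->
  co v n * (- lor y y / (2 * co y n)) <= - lor v y.
Proof.
move=> v0 T0 y0 Y0.
have := cauchy_schwarz_sum xpredT (fun i : 'I_n => co v i) (fun i : 'I_n => co y i).
move: v0 y0; rewrite !lorE.
set s := \sum_(i < n) co v i * co y i.
under eq_bigr do rewrite -expr2; set a := \sum_(i < n) co v i ^+ 2.
under eq_bigr do rewrite -expr2; set b := \sum_(i < n) co y i ^+ 2.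
move: (co v n) (co y n) T0 Y0 => T Y T0 Y0 aT bY sab.
have b0 : 0 <= b by apply: sumr_ge0 => i _; apply: sqr_ge0.
have q0 : 0 < Y * Y - b by lra.
(* This number is [(Y * Y + b) / (2 * Y)], an upper bound for the square root of [b] by the
   arithmetic-geometric inequality. *)
have k0 : 0 <= Y - (Y * Y - b) / (2 * Y).
  have -> : Y - (Y * Y - b) / (2 * Y) = (Y * Y + b) / (2 * Y).
    by field; rewrite gt_eqF.
  by apply: divr_ge0; nra.
have : s <= T * (Y - (Y * Y - b) / (2 * Y)).
  apply: le_trans (ler_norm s) _.
  rewrite -ler_sqr ?nnegrE ?mulr_ge0 // real_normK ?num_real //.
  apply: le_trans sab _; rewrite exprMn; apply: ler_pM => //.
  - by apply: sumr_ge0 => i _; apply: sqr_ge0.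
  - by rewrite expr2; lra.
  have -> : (Y - (Y * Y - b) / (2 * Y)) ^+ 2 = b + ((Y * Y - b) / (2 * Y)) ^+ 2.
    by field; rewrite gt_eqF.
  by rewrite lerDl sqr_ge0.
rewrite mulrBr.
have -> : - (b - Y * Y) = Y * Y - b by ring.
by move: (T * (_ / _)) => u; lra.
Qed.

Lemma causal_slope_gt0 y : lor y y < 0 -> 0 < co y n ->
  0 < - lor y y / (2 * co y n).
Proof. by move=> y0 Y0; rewrite divr_gt0 ?oppr_gt0 ?mulr_gt0. Qed.

(** Otherwise [- v] would be causal with nonnegative height, and its product with [y] could not be
    positive. *)
Lemma lor_lt0_future v y :
  lor v v <= 0 -> lor y y < 0 -> 0 < co y n -> lor v y < 0 -> 0 < co v n.
Proof.
move=> v0 y0 Y0 vy; rewrite ltNge; apply/negP => T0.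
have := @lor_causal_timelike (- v) y.
rewrite !lorL coordN opprK oppr_ge0 => /(_ v0 T0 y0 Y0).
have := causal_slope_gt0 y0 Y0.
move: (_ / _) => k k0 H.
have : 0 <= - co v n * k by rewrite mulr_ge0 ?oppr_ge0 // ltW.
lra.
Qed.

Lemma future_lor_lt0 v y :
  lor v v <= 0 -> 0 < co v n -> lor y y < 0 -> 0 < co y n -> lor v y < 0.
Proof.
move=> v0 T0 y0 Y0.
have := lor_causal_timelike v0 (ltW T0) y0 Y0.
have := mulr_gt0 T0 (causal_slope_gt0 y0 Y0).
by move: (_ * (_ / _)) => k; lra.
Qed.

Lemma timelike_coord_neq0 v : lor v v < 0 -> co v n != 0.
Proof.
move=> v0; apply/eqP => T0; move: v0; rewrite lorE T0 mul0r subr0 ltNge.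
by rewrite sumr_ge0 // => i _; rewrite -expr2 sqr_ge0.
Qed.

(** A causal vector orthogonal to [y] is neither future nor past, so its height is 0, and the height
    dominates every other coordinate. *)
Lemma lor_orthogonal_timelike_gt0 v y :
  lor y y < 0 -> lor v y = 0 -> v != 0 -> 0 < lor v v.
Proof.
move=> yt vy vn0; rewrite ltNge; apply/negP => v0.
wlog Y0 : y yt vy / 0 < co y n.
  have := timelike_coord_neq0 yt; rewrite neq_lt => /orP[Y0|Y0] H; last exact: (H y).
  by apply: (H (- y)); rewrite ?coordN ?lorL ?opprK ?vy ?oppr0 // oppr_gt0.
have T0 : co v n = 0.
  apply/eqP; apply/negPn/negP; rewrite neq_lt => /orP[T0|T0].
    have := @future_lor_lt0 (- v) y.
    by rewrite !lorL opprK coordN oppr_gt0 vy oppr0 ltxx => /(_ v0 T0 yt Y0).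
  by have := future_lor_lt0 v0 T0 yt Y0; rewrite vy ltxx.
case/eqP: vn0; apply: coord_ext => k kn; rewrite coord0; apply/eqP.
by rewrite -normr_le0 (le_trans (coord_causal_le v0 kn)) // T0 normr0.
Qed.

Lemma timelike_normalize v : lor v v < 0 -> 0 < co v n ->
  exists2 s : R, 0 < s & Hn (s *: v).
Proof.
move=> v0 T0; exists (Num.sqrt (- lor v v))^-1.
  by rewrite invr_gt0 sqrtr_gt0 oppr_gt0.
have s0 : 0 < Num.sqrt (- lor v v) by rewrite sqrtr_gt0 oppr_gt0.
split; last by rewrite coord_max coordZ mulr_gt0 ?invr_gt0.
set r := Num.sqrt _ in s0 *.
have Er : lor v v = - (r * r).
  by rewrite -expr2 sqr_sqrtr ?opprK // oppr_ge0 ltW.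
by rewrite !lorL Er; field; rewrite gt_eqF.
Qed.

End Lorentz.

(** * Reflections and the groups they generate *)

Section Isometries.
Variables (R : realType) (n : nat).
Implicit Types (x y z v w e : vec R n) (A B C : mat R n) (S : set (mat R n)).

Lemma mulmx_refl w x : refl w *m x = x - (2 * lor x w / lor w w) *: w.
Proof.
rewrite /refl mulmxBl mul1mx -scalemxAl -mulmxA.
set r := (X in w *m X).
have -> : r = (lor x w)%:M.
  apply/matrixP => i j; rewrite !ord1 !mxE eqxx mulr1n; apply: eq_bigr => k _.
  by rewrite !mxE; case: ifP => _; ring.
by rewrite mul_mx_scalar scalerA mulrAC.
Qed.

Lemma mulmx_ext A B : (forall x, A *m x = B *m x) -> A = B.
Proof.
move=> H; apply/matrixP => i j.
have jn : (j <= n)%N by rewrite -ltnS.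
have := congr1 (fun x : vec R n => x i 0) (H (evec R n j.+1)).
by rewrite !coord_evec_mulmx // inord_val.
Qed.

Lemma lorentzian_refl w : lor w w != 0 -> lorentzian (refl w).
Proof.
by move=> w0 x y; rewrite !mulmx_refl !lorL (lorC w y); field.
Qed.

Lemma refl_involutive w : lor w w != 0 -> refl w * refl w = 1.
Proof.
move=> w0; apply: mulmx_ext => x; rewrite -mulmxA mul1mx !mulmx_refl !lorL.
rewrite -addrA -opprD -scalerDl; set a := (X in X *: w).
suff -> : a = 0 by rewrite scale0r subr0.
by rewrite /a; field.
Qed.

(** The product of [x] with its image is [lor x x - 2 (lor x w)^2 / lor w w < 0], so both lie in the
    same half of the light cone. *)
Lemma positive_refl w : 0 < lor w w -> positive (refl w).
Proof.
move=> w0 x xt xf; rewrite coord_max; rewrite coord_max in xf.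
have w1 := lt0r_neq0 w0.
apply: (@lor_lt0_future _ _ _ x) => //.
  by rewrite (lorentzian_refl w1) ltW.
rewrite mulmx_refl !lorL (lorC w x).
have : 0 <= 2 * lor x w / lor w w * lor x w.
  have -> : 2 * lor x w / lor w w * lor x w = 2 * (lor x w ^+ 2 / lor w w) by field.
  apply: mulr_ge0 => //.
  by apply: divr_ge0; [exact: sqr_ge0|exact: ltW].
by move: (_ / _ * _) => u; lra.
Qed.

(** * The Lorentzian adjoint; products and inverses in [Gamma] and [Gamma2] *)

Definition lor_sign (i : 'I_n.+1) : R := (-1) ^+ (i == ord_max).

Lemma lor_signE x y : lor x y = \sum_i lor_sign i * x i 0 * y i 0.
Proof.
by apply: eq_bigr => i _; rewrite /lor_sign; case: eqP => _; rewrite ?expr0 ?expr1; ring.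
Qed.

(** This is [J A^T J] with [J = diag(1, ..., 1, -1)]: the inverse of a Lorentzian matrix, with
    integrality and congruence modulo 2 visible on its entries. *)
Definition lor_adj A : mat R n := \matrix_(i, j) (lor_sign i * lor_sign j * A j i).

Lemma lor_signK i : lor_sign i * lor_sign i = 1.
Proof. by rewrite /lor_sign; case: eqP => _; rewrite ?expr0 ?expr1; ring. Qed.

Lemma lor_sign_int i : lor_sign i \is a Num.int.
Proof. by rewrite rpredX // rpredN rpred1. Qed.

Lemma lor_adjP A x y : lor (A *m x) y = lor x (lor_adj A *m y).
Proof.
rewrite !lor_signE.
under eq_bigr => i _ do rewrite mxE mulr_sumr mulr_suml.
rewrite exchange_big /=; apply: eq_bigr => j _.
rewrite mxE mulr_sumr; apply: eq_bigr => i _; rewrite mxE.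
by rewrite -[LHS]mul1r -(lor_signK j); ring.
Qed.

Lemma lor_adjK A : lorentzian A -> lor_adj A *m A = 1%:M.
Proof.
move=> lA; apply: mulmx_ext => x; rewrite mul1mx; apply: lor_nondeg => z.
by rewrite lorC -mulmxA -lor_adjP lA lorC.
Qed.

Lemma lor_adjVK A : lorentzian A -> A *m lor_adj A = 1%:M.
Proof. by move=> lA; apply: mulmx1C; apply: lor_adjK. Qed.

Lemma Gamma_adj A : Gamma A -> Gamma (lor_adj A).
Proof.
move=> [lA [pA iA]]; have lA' : lorentzian (lor_adj A).
  by move=> x y; rewrite -lA !mulmxA lor_adjVK // !mul1mx.
split=> //; split; last first.
  by move=> i j; rewrite mxE !rpredM ?lor_sign_int.
move=> x xt xf; rewrite coord_max.
have yt : lor (lor_adj A *m x) (lor_adj A *m x) < 0 by rewrite lA'.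
have := timelike_coord_neq0 yt; rewrite neq_lt => /orP[|//] yn.
(* Were the image of [x] in the past, [A] would send its negative, a future vector, to [- x]. *)
have := pA (- (lor_adj A *m x)).
rewrite !lorL opprK mulmxN mulmxA lor_adjVK // mul1mx !coord_max !coordN.
rewrite oppr_gt0 => /(_ yt yn); rewrite -coord_max; lra.
Qed.

Lemma Gamma2_adj A : Gamma2 A -> Gamma2 (lor_adj A).
Proof.
move=> [gA eA]; split; first exact: Gamma_adj.
move=> i j; rewrite mxE.
have -> : (lor_sign i * lor_sign j * A j i - (i == j)%:R) / 2 =
          lor_sign i * lor_sign j * ((A j i - (j == i)%:R) / 2).
  rewrite eq_sym; case: (eqVneq j i) => [->|_]; first by rewrite lor_signK; field.
  by rewrite !subr0; field.
by rewrite rpredM ?eA // rpredM ?lor_sign_int.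
Qed.

Lemma Gamma_mul A B : Gamma A -> Gamma B -> Gamma (A * B).
Proof.
move=> [lA [pA iA]] [lB [pB iB]]; split; [|split].
- by move=> x y; rewrite -!mulmxA lA lB.
- by move=> x xt xf; rewrite -mulmxA; apply: pA; [rewrite lB|apply: pB].
- by move=> i j; rewrite mxE rpred_sum // => k _; rewrite rpredM.
Qed.

Lemma Gamma2_mul A B : Gamma2 A -> Gamma2 B -> Gamma2 (A * B).
Proof.
move=> [gA eA] [gB eB]; split; first exact: Gamma_mul.
move=> i j.
(* Entrywise form of [A B - 1 = (A - 1) B + (B - 1)]. *)
have -> : ((A * B) i j - (i == j)%:R) / 2 =
    \sum_k (A i k - (i == k)%:R) / 2 * B k j + (B i j - (i == j)%:R) / 2.
  under eq_bigr do rewrite mulrAC mulrBl.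
  have id_row : \sum_k (i == k)%:R * B k j = B i j.
    rewrite (bigD1 i) //= eqxx mul1r big1 ?addr0 // => k /negPf.
    by rewrite eq_sym => ->; rewrite mul0r.
  by rewrite -mulr_suml sumrB id_row mxE; field.
rewrite rpredD // rpred_sum // => k _; rewrite rpredM //.
by case: gB => _ [_].
Qed.

Lemma Gamma1 : Gamma (1 : mat R n).
Proof.
split; [|split].
- by move=> x y; rewrite !mul1mx.
- by move=> x _; rewrite mul1mx.
- by move=> i j; rewrite mxE rpred_nat.
Qed.

Lemma Gamma2_1 : Gamma2 (1 : mat R n).
Proof.
by split; [exact: Gamma1 | move=> i j; rewrite mxE subrr mul0r rpred0].
Qed.

(** * Integral and even vectors, and reflections in integral vectors *)

Definition integral v : Prop := forall i, v i 0 \is a Num.int.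
Definition even v : Prop := forall i, v i 0 / 2 \is a Num.int.

Lemma integral_mulmx A v : (forall i j, A i j \is a Num.int) ->
  integral v -> integral (A *m v).
Proof. by move=> iA iv i; rewrite mxE rpred_sum // => k _; rewrite rpredM. Qed.

Lemma even_mulmx A v : (forall i j, A i j \is a Num.int) ->
  even v -> even (A *m v).
Proof.
move=> iA iv i; rewrite mxE mulr_suml rpred_sum // => k _.
by rewrite -mulrA rpredM.
Qed.

Lemma lor_int x y : integral x -> integral y -> lor x y \is a Num.int.
Proof.
by move=> ix iy; rewrite lor_signE rpred_sum // => i _; rewrite !rpredM ?lor_sign_int.
Qed.

Lemma Gamma2_even A v : Gamma2 A -> integral v -> even (A *m v - v).
Proof.
move=> [gA eA] iv i.
have -> : A *m v - v = (A - 1) *m v by rewrite mulmxBl mul1mx.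
rewrite mxE mulr_suml rpred_sum // => j _; rewrite mulrAC rpredM //.
by have := eA i j; rewrite !mxE.
Qed.

Lemma refl_entry w i j :
  refl w i j = (i == j)%:R - 2 / lor w w * (w i 0 * (lor_sign j * w j 0)).
Proof.
rewrite !mxE big_ord1 !mxE /lor_sign; case: (j == ord_max).
  by rewrite expr1 mulN1r.
by rewrite expr0 mul1r.
Qed.

Lemma Gamma_refl w : integral w -> lor w w = 1 \/ lor w w = 2 -> Gamma (refl w).
Proof.
move=> iw w12; have w0 : 0 < lor w w by case: w12 => ->.
split; [|split]; [by apply: lorentzian_refl; rewrite gt_eqF|exact: positive_refl|].
move=> i j; rewrite refl_entry rpredB ?rpred_nat // rpredM //; last first.
  by rewrite !rpredM ?lor_sign_int.
by case: w12 => ->; rewrite ?divr1 ?divff ?rpred1 ?rpred_nat.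
Qed.

Lemma Gamma2_refl w : integral w -> lor w w = 1 -> Gamma2 (refl w).
Proof.
move=> iw w1; split; first by apply: Gamma_refl => //; left.
move=> i j; rewrite refl_entry w1.
set u := w i 0 * _.
have -> : ((i == j)%:R - 2 / 1 * u - (i == j)%:R) / 2 = - u by field.
by rewrite rpredN !rpredM ?lor_sign_int.
Qed.

(** * Groups generated by involutions *)

Lemma gen1 S : gen S 1.
Proof. by exists [::]; split=> //; rewrite big_nil. Qed.

Lemma gen_base S A : S A -> gen S A.
Proof.
move=> SA; exists [:: A]; rewrite big_seq1; split=> // B.
by rewrite inE => /eqP ->; left.
Qed.

Lemma genM S A B : gen S A -> gen S B -> gen S (A * B).
Proof.
move=> [s [sS ->]] [t [tS ->]]; exists (s ++ t); rewrite big_cat; split=> // C.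
by rewrite mem_cat => /orP[/sS|/tS].
Qed.

Lemma gen_involutive_ind S (P : mat R n -> Prop) :
  (forall C, S C -> C * C = 1) -> P 1 ->
  (forall C A, S C -> gen S A -> P A -> P (C * A)) -> forall A, gen S A -> P A.
Proof.
move=> SS P1 PM A [s [sS ->]]; elim: s sS => [|B s IH] sS; first by rewrite big_nil.
have sS' C : C \in s -> S C \/ exists D, S D /\ C = invmx D.
  by move=> Cs; apply: sS; rewrite inE Cs orbT.
rewrite big_cons; apply: PM; [|by exists s|exact: IH].
have [//|[C [SC ->]]] := sS B (mem_head _ _).
have CC := SS _ SC; have [uC _] := mulmx1_unit CC.
suff -> : invmx C = C by [].
by rewrite -[LHS]mulmx1 -[1%:M]CC mulmxA mulVmx // mul1mx.
Qed.

Lemma gen_involutive_inv S A : (forall C, S C -> C * C = 1) -> gen S A ->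
  exists A', [/\ gen S A', A * A' = 1 & A' * A = 1].
Proof.
move=> SS; move: A; apply: gen_involutive_ind => // [|C A SC _ [A' [gA' AA' A'A]]].
  by exists 1; rewrite mulr1; split=> //; exact: gen1.
exists (A' * C); split.
- exact: genM gA' (gen_base SC).
- by rewrite mulrA -(mulrA C) AA' mulr1 SS.
- by rewrite mulrA -(mulrA A') SS // mulr1.
Qed.

(** * Finiteness of integral vectors of bounded height *)

Lemma integral_box (B : nat) : exists L : seq (vec R n),
  forall v, integral v -> (forall k, (k <= n)%N -> `|co v k| <= B%:R) -> v \in L.
Proof.
pose F (f : {ffun 'I_n.+1 -> 'I_(2 * B).+1}) : vec R n := \col_i ((f i)%:R - B%:R).
exists (codom F) => v iv vB.
suff [f ->] : exists f, v = F f by apply: codom_f.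
exists [ffun i => inord `|Num.floor (v i 0) + B%:Z|]; apply/colP => i.
rewrite mxE ffunE.
have [z Ez] : exists z : int, v i 0 = z%:~R by apply/intrP; exact: iv.
have := vB i; rewrite -ltnS ltn_ord => /(_ isT); rewrite -coordE Ez.
rewrite intrKfloor -intr_norm -[B%:R]/(B%:Z%:~R) ler_int => zB.
rewrite inordK; last by lia.
have -> : (absz (z + B%:Z))%:R = (z + B%:Z)%:~R :> R.
  by rewrite -[LHS]/((absz (z + B%:Z))%:Z%:~R); congr (_%:~R); lia.
by rewrite intrD addrK.
Qed.

(** By the reverse Cauchy-Schwarz inequality a bound on [- lor u y] bounds the height of [u], hence
    all its coordinates, and leaves finitely many integral candidates. *)
Lemma integral_causal_argmin (T : set (vec R n)) y :
  (forall v, T v -> [/\ integral v, lor v v <= 0 & 0 < co v n]) ->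
  lor y y < 0 -> 0 < co y n -> T !=set0 ->
  exists2 v, T v & forall u, T u -> - lor v y <= - lor u y.
Proof.
move=> Tc y0 Y0 [v0 Tv0].
set k := - lor y y / (2 * co y n).
have k0 : 0 < k by exact: causal_slope_gt0.
have [L LP] := integral_box (Num.bound (- lor v0 y / k)).
have inL u : T u -> - lor u y <= - lor v0 y -> u \in [seq u <- L | `[< T u >]].
  move=> Tu le; rewrite mem_filter asboolT //=.
  have [iu cu fu] := Tc _ Tu; apply: LP => // i iN.
  apply: le_trans (coord_causal_le cu iN) _; rewrite gtr0_norm //.
  apply: le_trans (_ : - lor v0 y / k <= _); last first.
    apply/ltW/archi_boundP; rewrite divr_ge0 ?oppr_ge0 ?ltW //.
    by have [_ ? ?] := Tc _ Tv0; apply: future_lor_lt0.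
  rewrite ler_pdivlMr //; apply: le_trans le.
  exact: lor_causal_timelike (ltW fu) _ _.
have [v + vm] := seq_argmin (fun u => - lor u y) (inL _ Tv0 (lexx _)).
rewrite mem_filter => /andP[/asboolP Tv _]; exists v => // u Tu.
have [le|/ltW lt] := leP (- lor u y) (- lor v0 y); first exact: vm (inL _ Tu le).
exact: le_trans (vm _ (inL _ Tv0 (lexx _))) lt.
Qed.

(** Adjunction turns a minimum over images of the real vector [y] into one over the integral vectors
    [lor_adj A *m u]. *)
Lemma Gamma_orbit_argmin (G : set (mat R n)) u y :
  G `<=` @Gamma R n -> G !=set0 ->
  integral u -> lor u u < 0 -> 0 < co u n -> lor y y < 0 -> 0 < co y n ->
  exists2 A, G A & forall B, G B -> - lor (A *m y) u <= - lor (B *m y) u.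
Proof.
move=> GG [A0 GA0] iu u0 U0 y0 Y0.
have [v [A GA <-] vm] : exists2 v, [set lor_adj A *m u | A in G] v &
    forall w, [set lor_adj A *m u | A in G] w -> - lor v y <= - lor w y.
  apply: integral_causal_argmin => //; last by exists (lor_adj A0 *m u), A0.
  move=> _ [A /GG /Gamma_adj [lA [pA iA]] <-]; split.
  - exact: integral_mulmx.
  - by rewrite lA ltW.
  - by rewrite -coord_max pA // coord_max.
exists A => // B GB; rewrite !lor_adjP !(lorC y).
by apply: vm; exists B.
Qed.

End Isometries.

(** * Normals of the sides *)

Section Sides.
Variables (R : realType) (n : nat).
Hypothesis n_range : (2 <= n <= 7)%N.
Implicit Types (x y z v w e f : vec R n) (A B C : mat R n).

(* Up to sign and coordinate order, this is the canonical class of the blow-up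
   of the plane at [n] points; the side normals below are the classes of the
   exceptional curves on it. *)
Definition center : vec R n := \col_i (if i == ord_max then 3 else 1).

Lemma coord_center k : (k <= n)%N -> co center k = if k == n then 3 else 1.
Proof. by move=> kn; rewrite /Defs.coord mxE /= -val_eqE /= inordK. Qed.

Lemma coord_center_lt k : (k < n)%N -> co center k = 1.
Proof. by move=> kn; rewrite coord_center ?(ltnW kn) // (ltn_eqF kn). Qed.

Lemma coord_center_max : co center n = 3.
Proof. by rewrite coord_center // eqxx. Qed.

Lemma lor_center x : lor x center = \sum_(i < n) co x i - 3 * co x n.
Proof.
rewrite lorE coord_center_max mulrC; congr (_ - _).
by apply: eq_bigr => i _; rewrite coord_center_lt // mulr1.
Qed.

Lemma lor_center_center : lor center center = n%:R - 9.
Proof.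
rewrite lor_center coord_center_max (eq_bigr (fun=> 1)) => [|i _]; last first.
  by rewrite coord_center_lt.
by rewrite sumr_const card_ord; ring.
Qed.

Lemma natr_range : 2 <= n%:R :> R /\ n%:R <= 7 :> R.
Proof. by rewrite !ler_nat; apply/andP. Qed.

Lemma center_timelike : lor center center < 0.
Proof. by rewrite lor_center_center; have := natr_range; lra. Qed.

Lemma center_future : 0 < co center n.
Proof. by rewrite coord_center_max. Qed.

Lemma center_integral : integral center.
Proof. by move=> i; rewrite mxE; case: ifP => _; rewrite ?rpred1 ?rpred_nat. Qed.

Definition side_normal e : Prop :=
  [/\ integral e, lor e e = 1 & lor e center = -1].

(** Cauchy-Schwarz between the at most 6 space coordinates other than the [j]-th and the constant 1;
    their sum and sum of squares are known from [<e,c> = -1] and [<e,e> = 1]. *)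
Lemma side_normal_quadric e j : side_normal e -> (j < n)%N ->
  (3 * co e n - 1 - co e j) ^+ 2 <= 6 * (co e n ^+ 2 + 1 - co e j ^+ 2).
Proof.
move=> [_ e1 ec] jn.
have := cauchy_schwarz_sum (fun i => i != Ordinal jn)
  (fun i : 'I_n => co e i) (fun=> 1).
set a := \sum_(i < n | i != Ordinal jn) co e i.
set b := \sum_(i < n | i != Ordinal jn) co e i ^+ 2.
under eq_bigr do rewrite mulr1.
under [X in _ * X]eq_bigr do rewrite expr1n.
rewrite -/a -/b sumr_const cardC1 card_ord => ab.
have sum_e : \sum_(i < n) co e i = co e j + a by rewrite (bigD1 (Ordinal jn)).
have sum_e2 : \sum_(i < n) co e i * co e i = co e j * co e j + b.
  by rewrite (bigD1 (Ordinal jn)).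
move: e1 ec; rewrite lor_center lorE sum_e sum_e2 => e1 ec.
have b0 : 0 <= b by apply: sumr_ge0 => i _; apply: sqr_ge0.
have n6 : n.-1%:R <= 6 :> R by rewrite ler_nat; move: n_range; lia.
have -> : 3 * co e n - 1 - co e j = a by lra.
have -> : co e n ^+ 2 + 1 - co e j ^+ 2 = b by rewrite !expr2; lra.
apply: le_trans ab _; rewrite mulrC; exact: ler_wpM2r.
Qed.

(** With the norm and the product with [center], the cases describe [- e_i], [e_i + e_j + e_{n+1}],
    five ones at height 2, and, for [n = 7], a two and six ones at height 3: exceptional curves,
    lines, conics and nodal cubics. *)
Lemma side_normal_cases e j : side_normal e -> (j < n)%N ->
  [\/ co e n = 0 /\ (co e j = -1 \/ co e j = 0),
      co e n = 1 /\ (co e j = 0 \/ co e j = 1),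
      co e n = 2 /\ (co e j = 0 \/ co e j = 1) |
      co e n = 3 /\ (co e j = 1 \/ co e j = 2)].
Proof.
move=> se jn; have := side_normal_quadric se jn.
have [ie _ _] := se.
have /intrP[d ->] : co e n \is a Num.int by exact: ie.
have /intrP[m ->] : co e j \is a Num.int by exact: ie.
have -> : 3 * d%:~R - 1 - m%:~R = (3 * d - 1 - m)%:~R :> R by rewrite !rmorphB rmorphM.
rewrite -!rmorphXn /= -[1]/(1%:~R) -[6]/(6%:~R) -intrD -intrB -intrM ler_int.
rewrite !expr2 => H.
(* Completing the square in [m] eliminates it and leaves a bound on [d] alone. *)
have d2 : d * d <= 3 * d + 3.
  by have := sqr_ge0 (7 * m + 1 - 3 * d); rewrite expr2; lia.
have d03 : 0 <= d /\ d <= 3 by split; nia.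
have : d = 0 \/ d = 1 \/ d = 2 \/ d = 3 by lia.
move=> [|[|[]]] Ed; move: H; rewrite Ed => H.
- apply: Or41; split=> //.
  have [->|->] : m = -1 \/ m = 0 by nia.
    by left.
  by right.
- apply: Or42; split=> //.
  have [->|->] : m = 0 \/ m = 1 by nia.
    by left.
  by right.
- apply: Or43; split=> //.
  have [->|->] : m = 0 \/ m = 1 by nia.
    by left.
  by right.
- apply: Or44; split=> //.
  have [->|->] : m = 1 \/ m = 2 by nia.
    by left.
  by right.
Qed.

Lemma side_normal_coord_le e j : side_normal e -> (j < n)%N -> co e j <= co e n.
Proof.
by move=> se jn; have [] := side_normal_cases se jn => -[-> [] ->]; lra.
Qed.

Lemma side_normal_signs e : side_normal e ->
  co e n = 0 \/ 1 <= co e n /\ forall j, (j < n)%N -> 0 <= co e j.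
Proof.
move=> se; have n0 : (0 < n)%N by case/andP: n_range => /ltnW.
have [d0|dn0] := eqVneq (co e n) 0; [by left|right]; split.
  by case: (side_normal_cases se n0) => -[E _]; [case/eqP: dn0|..]; rewrite E; lra.
by move=> j jn; case: (side_normal_cases se jn) => -[E [] ->];
  [case/eqP: dn0|lra..].
Qed.

Lemma side_normal_bounded e k : side_normal e -> (k <= n)%N -> `|co e k| <= 3%:R.
Proof.
move=> se; rewrite leq_eqVlt => /orP[/eqP ->|kn].
  have n0 : (0 < n)%N by case/andP: n_range => /ltnW.
  by have [] := side_normal_cases se n0 => -[-> _]; rewrite ger0_norm; lra.
have [] := side_normal_cases se kn => -[_ [] ->];
  by rewrite ?normrN ger0_norm; lra.
Qed.

Lemma side_normal_finite : exists E : seq (vec R n), forall e, e \in E <-> side_normal e.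
Proof.
have [L LP] := integral_box R n 3.
exists [seq e <- L | `[< side_normal e >]] => e; rewrite mem_filter.
split=> [/andP[/asboolP]//|se]; rewrite asboolT //=.
by apply: LP => [|k]; [case: se|exact: side_normal_bounded].
Qed.

Lemma side_normal_lor_le0 e f : side_normal e -> side_normal f -> e != f ->
  lor e f <= 0.
Proof.
move=> [ie e1 ec] [jf f1 fc] ef.
have : 0 < lor (e - f) (e - f).
  apply: (lor_orthogonal_timelike_gt0 center_timelike); last by rewrite subr_eq0.
  by rewrite !lorL ec fc; ring.
rewrite !lorL e1 f1 (lorC f e).
have /intrP[m ->] := lor_int ie jf; rewrite -[0]/(0%:~R) ler_int => H.
have : m%:~R < 1%:~R :> R by rewrite -[1%:~R]/(1 : R); lra.
by rewrite ltr_int; lia.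
Qed.

Lemma side_normal_mulmx A e : Gamma A -> A *m center = center ->
  side_normal e -> side_normal (A *m e).
Proof.
move=> [lA [_ iA]] Ac [ie e1 ec]; split; first exact: integral_mulmx.
- by rewrite lA.
- by rewrite -Ac lA.
Qed.

(** * Explicit side normals, points on the sides, and parity *)

Lemma evec_integral k : integral (evec R n k).
Proof. by move=> i; rewrite mxE; case: ifP; rewrite ?rpred0 ?rpred1. Qed.

Lemma integralD x y : integral x -> integral y -> integral (x + y).
Proof. by move=> ix iy i; rewrite mxE rpredD. Qed.
Lemma integralN x : integral x -> integral (- x).
Proof. by move=> ix i; rewrite mxE rpredN. Qed.

Lemma lor_evec_center k : (k < n)%N -> lor (evec R n k.+1) center = 1.
Proof. by move=> kn; rewrite lorC lor_evec // coord_center_lt. Qed.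

Lemma lor_evec_evec j k : (j < n)%N -> (k < n)%N ->
  lor (evec R n j.+1) (evec R n k.+1) = (j == k)%:R.
Proof. by move=> jn kn; rewrite lor_evec // coord_evec ?(ltnW jn) ?(ltnW kn) // eq_sym. Qed.

Lemma side_normal_evec k : (k < n)%N -> side_normal (- evec R n k.+1).
Proof.
move=> kn; split; first exact/integralN/evec_integral.
- by rewrite !lorL opprK lor_evec_evec // eqxx.
- by rewrite lorL lor_evec_center.
Qed.

Lemma lor_evec_max_evec k : (k < n)%N -> lor (evec R n k.+1) (evec R n n.+1) = 0.
Proof.
by move=> kn; rewrite lor_evec_max coord_evec // ?(ltnW kn) // (gtn_eqF kn) oppr0.
Qed.

Lemma lor_evec_max_max : lor (evec R n n.+1) (evec R n n.+1) = -1.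
Proof. by rewrite lor_evec_max coord_evec // eqxx. Qed.

Lemma lor_evec_max_center : lor (evec R n n.+1) center = -3.
Proof. by rewrite lorC lor_evec_max coord_center_max. Qed.

Lemma side_normal_line : side_normal (evec R n 1 + evec R n 2 + evec R n n.+1).
Proof.
have n0 : (0 < n)%N by case/andP: n_range => /ltnW.
have n1 : (1 < n)%N by case/andP: n_range.
split; first by do !apply: integralD; exact: evec_integral.
  rewrite !lorL !(lorC (evec R n n.+1)) lor_evec_max_max !lor_evec_max_evec //.
  by rewrite !lor_evec_evec //=; ring.
by rewrite !lorL lor_evec_max_center !lor_evec_center //; ring.
Qed.

(** Rescaled, [center + e] will be the point lying on the side [e] only: its product with a normal
    [f] is [lor e f - 1]. *)
Lemma center_add_side_future e : side_normal e ->
  lor (center + e) (center + e) < 0 /\ 0 < co (center + e) n.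
Proof.
move=> se; have [_ e1 ec] := se; split.
  by rewrite !lorL e1 (lorC center e) ec lor_center_center; have := natr_range; lra.
rewrite coordD coord_center_max.
by case: (side_normal_signs se) => [->|[]]; lra.
Qed.

Lemma even_neq_odd (a : R) : a / 2 \is a Num.int -> [/\ a <> 1, a <> -1 & a <> 3].
Proof.
move=> /intrP[z Ez].
have Ea : a = (2 * z)%:~R by rewrite intrM -Ez; field.
rewrite Ea -[1]/(1%:~R) -[3]/(3%:~R) -intrN.
by split=> /intr_inj; lia.
Qed.

(** Parity singles out [- e_j] among the side normals; this will make elements of [Gamma2] fixing
    [center] trivial. *)
Lemma side_normal_even_evec e j : side_normal e -> (j < n)%N ->
  even (e + evec R n j.+1) -> e = - evec R n j.+1.
Proof.
move=> se jn ev; have [_ e1 _] := se.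
have evc k : (k <= n)%N -> (co e k + (k == j)%:R) / 2 \is a Num.int.
  by move=> kn; rewrite -(@coord_evec R n j k) ?(ltnW jn) // -coordD; apply: ev.
have evi i : (i < n)%N -> i != j -> co e i / 2 \is a Num.int.
  by move=> iN /negPf ij; have := evc i (ltnW iN); rewrite ij addr0.
have evn : co e n / 2 \is a Num.int.
  by have := evc n (leqnn n); rewrite (gtn_eqF jn) addr0.
have evj : (co e j + 1) / 2 \is a Num.int.
  by have := evc j (ltnW jn); rewrite eqxx.
(* The height is even, so 0 or 2, and in these shapes an even space coordinate is 0. *)
have e0 i : (i < n)%N -> i != j -> co e i = 0.
  move=> iN ij; have [h1 h2 _] := even_neq_odd (evi i iN ij).
  have [g1 _ g3] := even_neq_odd evn.
  by case: (side_normal_cases se iN) => -[d [H|H]].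
have [g1 _ g3] := even_neq_odd evn.
have [h1 _ h3] := even_neq_odd evj.
have [[d H]|[d H]] : co e n = 0 /\ co e j = -1 \/ co e n = 2 /\ co e j = 1.
- case: (side_normal_cases se jn) => -[d [H|H]]; try by [left|right|].
    by case: h1; rewrite H add0r.
  by case: h1; rewrite H add0r.
- apply: coord_ext => k; rewrite coordN leq_eqVlt => /orP[/eqP ->|kn].
    by rewrite coord_evec ?(ltnW jn) // (gtn_eqF jn) d oppr0.
  rewrite coord_evec ?(ltnW jn) ?(ltnW kn) //.
  by have [->|kj] := eqVneq k j; rewrite ?H // e0 // oppr0.
(* Height 2 with a single nonzero space coordinate 1 would give norm -3. *)
- move: e1; rewrite lorE (bigD1 (Ordinal jn)) //= H big1 => [|i ij].
    by rewrite d => e1; exfalso; lra.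
  by rewrite e0 ?mul0r.
Qed.

End Sides.
Arguments center {R n}.

(** * The simplex and its vertices *)

Section Simplex.
Variables (R : realType) (n : nat).
Hypothesis n_range : (2 <= n <= 7)%N.
Implicit Types (x y z v w e f : vec R n) (A B C : mat R n).

(* Space coordinates padded with zeros, so that the two shapes of the last
   inequality of [Delta] become one. *)
Definition space_coord x k : R := if (k < n)%N then co x k else 0.

(** The cone over [Delta]: without the normalization it also applies to integral vectors off the
    hyperboloid. *)
Definition Delta_cone x : Prop :=
  (forall k, space_coord x k.+1 <= space_coord x k) /\
  space_coord x 0 + space_coord x 1 + space_coord x 2 <= co x n.

Lemma n_gt0 : (0 < n)%N. Proof. by case/andP: n_range => /ltnW. Qed.
Lemma n_gt1 : (1 < n)%N. Proof. by case/andP: n_range. Qed.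

Lemma Delta_coneP x : Delta x <-> Hn x /\ Delta_cone x.
Proof.
have n0 := n_gt0; have n1 := n_gt1.
have last_cond : (if (3 <= n)%N
      then Defs.coord x 1 + Defs.coord x 2 + Defs.coord x 3 <= Defs.coord x n.+1
      else Defs.coord x 1 + Defs.coord x 2 <= Defs.coord x n.+1) =
    (space_coord x 0 + space_coord x 1 + space_coord x 2 <= co x n).
  by rewrite /space_coord n0 n1; case: ifP => // _; rewrite addr0.
have eq_last : Defs.coord x n = co x n.-1 by rewrite prednK.
split=> [[Hx [le [xn xl]]]|[Hx [le xl]]]; split=> //.
  split; last by rewrite -last_cond.
  move=> k; rewrite /space_coord; have [kn|kn] := ltnP k.+1 n.
    by rewrite (ltnW kn); apply: (le k.+1).
  case: ifP => // kn'; move: xn; rewrite eq_last.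
  by have -> : n.-1 = k by apply/eqP; rewrite -eqSS prednK // eqn_leq kn kn'.
split; [|split; last by rewrite last_cond].
  case=> [|k] // /= kn; have := le k; rewrite /space_coord.
  by rewrite kn (ltnW kn).
by have := le n.-1; rewrite /space_coord prednK // ltnn leqnn.
Qed.

(** With [e_{n+1}] these represent the vertices of the simplex; [vertex 1] is the ideal one, and
    [vertex n] is [center] when [n >= 3]. *)
Definition vertex k : vec R n :=
  \col_i (if i == ord_max then (minn k 3)%:R else (i < k)%:R).

Lemma coord_vertex_lt k i : (i < n)%N -> co (vertex k) i = (i < k)%:R.
Proof.
move=> iN; rewrite /Defs.coord mxE /= -val_eqE /= inordK ?(ltnW iN) //.
  by rewrite (ltn_eqF iN).
exact: ltnW.
Qed.

Lemma coord_vertex_max k : co (vertex k) n = (minn k 3)%:R.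
Proof. by rewrite /Defs.coord mxE /= -val_eqE /= inordK // eqxx. Qed.

(** Abel summation: the terms from [i] on telescope, and the padding makes [space_coord x n]
    zero. *)
Lemma space_coord_telescope x i :
  \sum_(k < n) (space_coord x k - space_coord x k.+1) * (i <= k)%:R = space_coord x i.
Proof.
have [ni|iN] := leqP n i.
  rewrite big1 /space_coord => [|k _]; first by rewrite ltnNge ni.
  by rewrite [(i <= k)%N]leqNgt (leq_trans (ltn_ord k) ni) mulr0.
rewrite -(big_mkord xpredT (fun k => (space_coord x k - space_coord x k.+1) * (i <= k)%:R)).
rewrite (big_cat_nat (n := i)) ?(ltnW iN) //= big_nat big1 ?add0r => [|k /andP[_ ki]].
  rewrite big_nat (eq_bigr (fun k => - space_coord x k.+1 - - space_coord x k)).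
    rewrite -big_nat telescope_sumr ?(ltnW iN) // {1}/space_coord ltnn.
    by rewrite opprK oppr0 add0r.
  by move=> k /andP[-> _]; rewrite mulr1 opprK addrC.
by rewrite leqNgt ki mulr0.
Qed.

(** The coefficients are the slacks of the inequalities of [Delta_cone], hence nonnegative on that
    cone. *)
Lemma vertex_decomposition x :
  x = \sum_(k < n) (space_coord x k - space_coord x k.+1) *: vertex k.+1 +
      (co x n - (space_coord x 0 + space_coord x 1 + space_coord x 2)) *: evec R n n.+1.
Proof.
apply: coord_ext => i; rewrite leq_eqVlt coordD coord_sum coordZ => /orP[/eqP ->|iN].
  (* Splits [minn k.+1 3] into the indicators of [0 <= k], [1 <= k] and [2 <= k]. *)
  rewrite coord_evec // eqxx mulr1 (eq_bigr (fun k : 'I_n =>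
      (space_coord x k - space_coord x k.+1) * (0 <= k)%:R +
      (space_coord x k - space_coord x k.+1) * (1 <= k)%:R +
      (space_coord x k - space_coord x k.+1) * (2 <= k)%:R)) => [|k _].
    have /= T0 := space_coord_telescope x 0.
    by rewrite !big_split /= T0 !space_coord_telescope; ring.
  rewrite coordZ coord_vertex_max -!mulrDr -!natrD; congr (_ * _%:R).
  by case: k => -[|[|k]] //= _; rewrite (minn_idPr _).
rewrite coord_evec ?(ltnW iN) // (ltn_eqF iN) mulr0 addr0.
rewrite -[LHS](_ : space_coord x i = _); last by rewrite /space_coord iN.
rewrite -space_coord_telescope; apply: eq_bigr => k _.
by rewrite coordZ coord_vertex_lt.
Qed.

Lemma lor_vertex k x :
  lor (vertex k) x = \sum_(i < n | (i < k)%N) co x i - (minn k 3)%:R * co x n.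
Proof.
rewrite lorE coord_vertex_max; congr (_ - _); rewrite [RHS]big_mkcond.
apply: eq_bigr => i _; rewrite coord_vertex_lt //.
by case: ifP => _; rewrite ?mul1r ?mul0r.
Qed.

Lemma sum_lt_const k (a : R) : (k <= n)%N -> \sum_(i < n | (i < k)%N) a = k%:R * a.
Proof.
move=> kn; rewrite (big_ord_narrow kn) sumr_const card_ord.
by rewrite mulr_natl.
Qed.

(** For [k <= 3] each space coordinate of [e] is at most the height. For larger [k], either the
    height is 0 and no space coordinate is positive, or all are nonnegative and the partial sum is
    at most the full one, [3 * co e n - 1]. *)
Lemma vertex_side_le0 e k : side_normal e -> (k <= n)%N -> lor (vertex k) e <= 0.
Proof.
move=> se kn; rewrite lor_vertex subr_le0.
have [k3|k3] := leqP k 3.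
  rewrite -(sum_lt_const _ kn); apply: ler_sum => i _.
  exact: side_normal_coord_le.
case: (side_normal_signs n_range se) => [d0|[d1 pos]].
  rewrite d0 mulr0; apply: sumr_le0 => i _.
  by rewrite -d0; exact: side_normal_coord_le.
have [_ _] := se; rewrite lor_center => ec.
apply: le_trans (_ : \sum_(i < n) co e i <= _); last by lra.
rewrite [leRHS](bigID (fun i : 'I_n => (i < k)%N)) /= lerDl.
by apply: sumr_ge0 => i _; apply: pos.
Qed.

Lemma evec_max_side_le0 e : side_normal e -> lor (evec R n n.+1) e <= 0.
Proof.
move=> se; rewrite lorC lor_evec_max oppr_le0.
by case: (side_normal_signs n_range se) => [->//|[]]; lra.
Qed.

Lemma Delta_cone_side_le0 x e : Delta_cone x -> side_normal e -> lor x e <= 0.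
Proof.
move=> [le xl] se; rewrite (vertex_decomposition x) lorDl lor_suml lorZl.
have e_max := evec_max_side_le0 se.
have ns : \sum_(k < n) lor ((space_coord x k - space_coord x k.+1) *: vertex k.+1) e <= 0.
  apply: sumr_le0 => k _; rewrite lorZl; apply: mulr_ge0_le0.
    by rewrite subr_ge0.
  exact: vertex_side_le0.
have : (co x n - (space_coord x 0 + space_coord x 1 + space_coord x 2)) *
         lor (evec R n n.+1) e <= 0.
  by apply: mulr_ge0_le0; rewrite ?subr_ge0.
lra.
Qed.

(** The crude bound 9 is preserved by [Sigma], which fixes [center]; it will confine the images of
    the vertices to a finite box. *)
Lemma vertex_causal k : (0 < k <= n)%N ->
  [/\ integral (vertex k), lor (vertex k) (vertex k) <= 0, 0 < co (vertex k) n
    & - lor (vertex k) center <= 9].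
Proof.
move=> /andP[k0 kn]; have k7 : (k <= 7)%N by apply: leq_trans kn _; case/andP: n_range.
have norm : lor (vertex k) (vertex k) = k%:R - (minn k 3)%:R * (minn k 3)%:R.
  rewrite lor_vertex coord_vertex_max (eq_bigr (fun=> 1)) => [|i ik].
    by rewrite sum_lt_const // mulr1.
  by rewrite coord_vertex_lt // ik.
have cent : lor (vertex k) center = k%:R - (minn k 3)%:R * 3.
  rewrite lor_vertex coord_center_max (eq_bigr (fun=> 1)) => [|i ik].
    by rewrite sum_lt_const // mulr1.
  by rewrite coord_center_lt.
split.
- by move=> i; rewrite mxE; case: ifP => _; rewrite rpred_nat.
- rewrite norm -natrM subr_le0 ler_nat; have [k3|k3] := leqP k 3; first by nia.
  lia.
- by rewrite coord_vertex_max ltr0n; lia.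
- have : (minn k 3)%:R <= 3 :> R by rewrite ler_nat geq_minr.
  have : 0 <= k%:R :> R by [].
  rewrite cent; lra.
Qed.

(** * The finite reflection group *)

(** Every root orthogonal to [center] qualifies, not only a simple system; the type is E_6 for
    [n = 6] and E_7 for [n = 7]. *)
Definition simple_root w : Prop := [/\ integral w, lor w w = 2 & lor w center = 0].

(** The sign makes this an outward normal of the chamber. *)
Definition swap_root k : vec R n := evec R n k.+2 - evec R n k.+1.

Lemma lor_swap_root x k : (k.+1 < n)%N -> lor x (swap_root k) = co x k.+1 - co x k.
Proof. by move=> kn; rewrite /swap_root !lorL !lor_evec // ltnW. Qed.

Lemma swap_root_simple k : (k.+1 < n)%N -> simple_root (swap_root k).
Proof.
move=> kn; split.
- by apply: integralD; [|apply: integralN]; exact: evec_integral.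
- rewrite lor_swap_root // /swap_root !coordL !coord_evec ?(ltnW kn) ?(ltnW (ltnW kn)) //.
  by rewrite !eqxx (ltn_eqF (ltnSn k)) (gtn_eqF (ltnSn k)) /=; ring.
- by rewrite /swap_root !lorL !lor_evec_center ?(ltnW kn) // subrr.
Qed.

Lemma lor_wvec x : (3 <= n)%N -> lor x (wvec R n) = co x 0 + co x 1 + co x 2 - co x n.
Proof.
by move=> n3; rewrite !lorL lor_evec_max !lor_evec ?n_gt0 ?n_gt1.
Qed.

Lemma wvec_simple : (3 <= n)%N -> simple_root (wvec R n).
Proof.
move=> n3; have n0 := n_gt0; have n1 := n_gt1; split.
- by do !apply: integralD; exact: evec_integral.
- rewrite lor_wvec // !coordL !coord_evec ?(ltnW n3) ?(ltnW n1) //=.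
  rewrite !eqxx !(gtn_eqF n3) !(gtn_eqF n0) !(gtn_eqF n1) !(ltn_eqF n3) !(ltn_eqF n0) !(ltn_eqF n1) /=.
  by ring.
- by rewrite lorC lor_wvec // coord_center_max !coord_center_lt //; ring.
Qed.

Lemma tperm_mx_refl k : (k.+1 < n)%N ->
  tperm_mx (inord k : 'I_n.+1) (inord k.+1) = refl (swap_root k).
Proof.
move=> kn; apply: mulmx_ext => x; have [_ r2 _] := swap_root_simple kn.
rewrite mulmx_refl r2 lor_swap_root // -xrowE.
have -> : 2 * (co x k.+1 - co x k) / 2 = co x k.+1 - co x k by field.
have k2 : (k.+1 < n.+1)%N := ltnW kn; have k1 : (k < n.+1)%N := ltnW k2.
apply/colP => i; rewrite !mxE /= -!val_eqE /= (inordK k1) (inordK k2).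
case: tpermP => [->|->|/eqP i1 /eqP i2].
- rewrite (inordK k1) eqxx (ltn_eqF (ltnSn k)) /Defs.coord /=; ring.
- rewrite (inordK k2) eqxx (gtn_eqF (ltnSn k)) /Defs.coord /=; ring.
move: i1 i2; rewrite -!val_eqE /= (inordK k1) (inordK k2).
by move=> /negPf -> /negPf ->; ring.
Qed.

Lemma Sigma_gens_refl A : Sigma_gens A -> exists2 w, simple_root w & A = refl w.
Proof.
case=> [[[|k] [// /= kn ->]]|[n3 ->]].
  by exists (swap_root k); [exact: swap_root_simple|rewrite tperm_mx_refl].
by exists (wvec R n) => //; exact: wvec_simple.
Qed.

Lemma Sigma_gens_involutive A : Sigma_gens A -> A * A = 1.
Proof.
by move=> /Sigma_gens_refl[w [_ w2 _] ->]; apply: refl_involutive; rewrite w2.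
Qed.

Lemma Sigma_Gamma A : Sigma A -> Gamma A /\ A *m center = center.
Proof.
move: A; apply: gen_involutive_ind.
- exact: Sigma_gens_involutive.
- by split; [exact: Gamma1|rewrite mul1mx].
move=> C A /Sigma_gens_refl[w [iw w2 wc] ->] _ [gA Ac]; split.
  by apply: Gamma_mul => //; apply: Gamma_refl => //; right.
by rewrite -mulmxA Ac mulmx_refl lorC wc mulr0 mul0r scale0r subr0.
Qed.

(** * Folding into the simplex; the inequalities describing [Pn] *)

Lemma adj_fix_center A : lorentzian A -> A *m center = center ->
  lor_adj A *m center = center :> vec R n.
Proof. by move=> lA Ac; rewrite -{1}Ac mulmxA lor_adjK // mul1mx. Qed.

(** An interior point of the chamber of [Sigma], with space coordinates [n, ..., 1]. The height 30
    exceeds the sum of the first three, at most 18, and makes the point time-like. *)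
Definition chamber_point : vec R n :=
  \col_i (if i == ord_max then 30 else (n - i)%:R).

Lemma coord_chamber_lt k : (k < n)%N -> co chamber_point k = (n - k)%:R.
Proof.
move=> kn; rewrite /Defs.coord mxE /= -val_eqE /= inordK ?(ltnW kn) //.
  by rewrite (ltn_eqF kn).
exact: ltnW.
Qed.

Lemma coord_chamber_max : co chamber_point n = 30.
Proof. by rewrite /Defs.coord mxE /= -val_eqE /= inordK // eqxx. Qed.

Lemma chamber_point_timelike : lor chamber_point chamber_point < 0.
Proof.
rewrite lorE coord_chamber_max subr_lt0.
have le49 : \sum_(i < n) co chamber_point i * co chamber_point i <= \sum_(i < n) 49%:R.
  apply: ler_sum => i _; rewrite coord_chamber_lt // -natrM ler_nat.
  by move: n_range; nia.
apply: le_lt_trans le49 _.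
by rewrite sumr_const card_ord -[_ *+ n]mulr_natr; have := natr_range R n_range; lra.
Qed.

Lemma chamber_point_integral : integral chamber_point.
Proof. by move=> i; rewrite mxE; case: ifP => _; rewrite rpred_nat. Qed.

(** Minimality gives the inequalities of the reflecting walls of [Sigma]. The other walls, [x_n = 0]
    and for [n = 2] also [x_1 + x_2 = x_3], come from side normals, so there the hypothesis on [y]
    applies. *)
Lemma Sigma_fold y : lor y y < 0 -> 0 < co y n ->
  (forall e, side_normal e -> lor y e <= 0) ->
  exists2 A, Sigma A & Delta_cone (A *m y).
Proof.
move=> yt yf ys; have n0 := n_gt0; have n1 := n_gt1.
have [A SA Amin] : exists2 A, Sigma A & forall B, Sigma B ->
    - lor (A *m y) chamber_point <= - lor (B *m y) chamber_point.
  apply: Gamma_orbit_argmin => //.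
  - by move=> B /Sigma_Gamma[].
  - by exists 1; exact: gen1.
  - exact: chamber_point_integral.
  - exact: chamber_point_timelike.
  - by rewrite coord_chamber_max.
have [gA Ac] := Sigma_Gamma SA; have [lA _] := gA.
exists A => //; set z := A *m y.
have zs e : side_normal e -> lor z e <= 0.
  move=> se; rewrite lor_adjP; apply: ys; apply: side_normal_mulmx => //.
    exact: Gamma_adj.
  exact: adj_fix_center.
(* Reflecting in a violated root [w] would change the minimized quantity by
   [lor z w * lor w chamber_point < 0]. *)
have zr w : Sigma_gens (refl w) -> simple_root w -> lor w chamber_point < 0 -> lor z w <= 0.
  move=> gw [_ w2 _] wu.
  have := Amin _ (genM (gen_base gw) SA).
  rewrite -mulmxA -/z mulmx_refl !lorL w2.
  have -> : 2 * lor z w / 2 = lor z w by field.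
  rewrite lerN2 lerBlDr lerDl => H.
  by rewrite leNgt; apply/negP => zw; nra.
have z_sorted k : (k.+1 < n)%N -> co z k.+1 <= co z k.
  move=> kn; rewrite -subr_le0 -lor_swap_root //; apply: zr.
  - by left; exists k.+1; rewrite /= kn tperm_mx_refl.
  - exact: swap_root_simple.
  rewrite lorC lor_swap_root // !coord_chamber_lt ?(ltnW kn) // subr_lt0 ltr_nat.
  by lia.
have z_last : 0 <= co z n.-1.
  have := zs _ (side_normal_evec _ (_ : (n.-1 < n)%N)).
  by rewrite prednK // leqnn lorNr => /(_ isT); rewrite lor_evec ?prednK // oppr_le0.
split.
  move=> k; rewrite /space_coord; have [kn|kn] := ltnP k.+1 n.
    by rewrite (ltnW kn); apply: z_sorted.
  case: ifP => // kn'.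
  by have -> : k = n.-1 by apply/eqP; rewrite -eqSS prednK // eqn_leq kn kn'.
rewrite /space_coord n0 n1; case: ifP => n3.
  rewrite -subr_le0 -lor_wvec //; apply: zr; [by right|exact: wvec_simple|].
  rewrite lorC lor_wvec // coord_chamber_max !coord_chamber_lt // -!natrD.
  by rewrite subr_lt0 ltr_nat; move: n_range; lia.
have := zs _ (side_normal_line R n_range).
by rewrite !lorL lor_evec_max !lor_evec // subr_le0 addr0.
Qed.

(** Elements of [Sigma] fix [center], so they preserve the set of side normals, and the inequalities
    pass from [Delta] to its images. Conversely, fold and carry back. *)
Lemma PnP x : Pn x <-> Hn x /\ forall e, side_normal e -> lor x e <= 0.
Proof.
split=> [[A [SA [d [/Delta_coneP[[d1 df] dd] ->]]]]|[[x1 xf] xs]].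
  have [gA Ac] := Sigma_Gamma SA; have [lA [pA _]] := gA; split.
    by split; [rewrite lA|apply: pA; rewrite ?d1 ?ltrN10].
  move=> e se; rewrite lor_adjP; apply: Delta_cone_side_le0 => //.
  apply: side_normal_mulmx => //; first exact: Gamma_adj.
  exact: adj_fix_center.
have [||A SA Ax] := @Sigma_fold x _ _ xs.
- by rewrite x1 ltrN10.
- by rewrite -coord_max.
have [[lA [pA _]] _] := Sigma_Gamma SA.
have [A' [SA' _ A'A]] := gen_involutive_inv Sigma_gens_involutive SA.
exists A'; split=> //; exists (A *m x); split; last first.
  by rewrite mulmxA [A' *m A]A'A mul1mx.
apply/Delta_coneP; split=> //; split; first by rewrite lA.
by apply: pA => //; rewrite x1 ltrN10.
Qed.

End Simplex.

(** * Descent towards the center *)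

Lemma sum_ord_ge3 (R : realType) (F : nat -> R) m : (3 <= m)%N ->
  \sum_(i < m) F i = F 0 + F 1 + F 2 + \sum_(3 <= i < m) F i.
Proof.
move=> m3; rewrite -(big_mkord xpredT F) big_ltn ?(ltn_trans _ m3) //.
by rewrite big_ltn ?(ltn_trans _ m3) // big_ltn // !addrA.
Qed.

Lemma sum_ord_eq2 (R : realType) (F : nat -> R) m : m = 2 ->
  \sum_(i < m) F i = F 0 + F 1.
Proof. by move=> ->; rewrite !big_ord_recl big_ord0 addr0. Qed.

Section Descent.
Variables (R : realType) (n : nat).
Hypothesis n_range : (2 <= n <= 7)%N.
Implicit Types (x y z v w e f : vec R n) (A B C : mat R n).

Lemma space_coord_le z i j : Delta_cone z -> (i <= j)%N ->
  space_coord z j <= space_coord z i.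
Proof.
move=> [le _] ij; rewrite -(subnK ij); elim: (j - i)%N => // d IH.
by rewrite addSn (le_trans (le _)).
Qed.

(* [v] could be the image of the center under an element of [Gamma2]; by
   [orbit_descent] all such vectors are. *)
Definition center_like v : Prop :=
  [/\ even (v - center), lor v v = lor (center : vec R n) center & 0 < co v n].

Lemma center_like_half v k : center_like v -> (k < n)%N ->
  (co v k - 1) / 2 \is a Num.int.
Proof.
move=> [ev _ _] kn.
have -> : co v k - 1 = co (v - center) k by rewrite coordD coordN coord_center_lt.
exact: ev.
Qed.

Lemma center_like_half_max v : center_like v -> (co v n - 3) / 2 \is a Num.int.
Proof.
move=> [ev _ _].
have -> : co v n - 3 = co (v - center) n by rewrite coordD coordN coord_center_max.
exact: ev.
Qed.

Lemma odd_ge1 (a : R) : 0 <= a -> (a - 1) / 2 \is a Num.int -> 1 <= a.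
Proof.
move=> a0 /intrP[m Em].
have Ea : a = (2 * m + 1)%:~R by rewrite intrD intrM -Em; field.
by move: a0; rewrite Ea ler0z ler1z; lia.
Qed.

Lemma center_like_Delta z : center_like z -> Delta_cone z -> z = center.
Proof.
move=> cz dz; have [ev zz zf] := cz; have n0 := n_gt0 n_range; have n1 := n_gt1 n_range.
have z_ge1 k : (k < n)%N -> 1 <= co z k.
  move=> kn; apply: odd_ge1; last exact: center_like_half.
  by have := space_coord_le dz (ltnW kn); rewrite /space_coord kn ltnn.
have z_le j k : (j <= k)%N -> (k < n)%N -> co z k <= co z j.
  move=> jk kn; have := space_coord_le dz jk.
  by rewrite /space_coord kn (leq_ltn_trans jk kn).
have [_ zl] := dz.
suff z0 : co z 0 <= 1.
  have z1 k : (k < n)%N -> co z k = 1.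
    by move=> kn; apply/eqP; rewrite eq_le z_ge1 // (le_trans (z_le 0 k _ _)).
  apply: coord_ext => k; rewrite leq_eqVlt => /orP[/eqP ->|kn]; last first.
    by rewrite coord_center_lt // z1.
  move: zz; rewrite lor_center_center lorE (eq_bigr (fun=> 1)) => [|i _]; last first.
    by rewrite z1 // mulr1.
  by rewrite sumr_const card_ord coord_center_max; nra.
move: zz; rewrite lor_center_center lorE.
have [n3|n2] := leqP 3 n.
  rewrite (sum_ord_ge3 (fun i => co z i * co z i)) //.
  have := z_le 0%N 1%N isT n1; have := z_le 1%N 2%N isT n3; have := z_ge1 2%N n3.
  have tail : \sum_(3 <= i < n) co z i * co z i <= (n%:R - 3) * (co z 2 * co z 2).
    apply: le_trans (_ : \sum_(3 <= i < n) co z 2 * co z 2 <= _).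
      apply: ler_sum_nat => i /andP[i3 iN].
      have := z_ge1 i iN; have := z_le 2%N i (ltnW i3) iN; nra.
    by rewrite sumr_const_nat -[_ *+ (n - 3)]mulr_natl natrB.
  move: zl; rewrite /space_coord n0 n1 n3.
  have [_] := natr_range R n_range.
  move: tail zf; move: (co z 0) (co z 1) (co z 2) (co z n) (\sum_(3 <= i < n) _).
  move: (n%:R : R) => N a b c t s tail t0 N7 abc c1 cb ba zz.
  have sq : (a + b + c) ^+ 2 <= t ^+ 2 by rewrite ler_sqr ?nnegrE; lra.
  (* The norm equation, [tail] and [sq] give [2a(b-c) + 2c(b-c) + 4c(a-c) + (9-N)(c^2-1) <= 0]; all
     terms are nonnegative, so each vanishes. *)
  have h1 : 0 <= a * (b - c) by apply: mulr_ge0; lra.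
  have h2 : 0 <= c * (b - c) by apply: mulr_ge0; lra.
  have h3 : 0 <= c * (a - c) by apply: mulr_ge0; lra.
  have h4 : 0 <= (9 - N) * (c * c - 1) by apply: mulr_ge0; nra.
  have [h5 h6] : c * (a - c) <= 0 /\ (9 - N) * (c * c - 1) <= 0.
    by split; move: sq; rewrite !expr2; lra.
  have N9 : 0 < 9 - N by lra.
  have cc : c * c - 1 <= 0 by rewrite -(pmulr_rle0 _ N9).
  have c_eq1 : c = 1 by apply/eqP; rewrite eq_le c1 andbT; nra.
  by rewrite c_eq1 in h5; lra.
have n_eq2 : n = 2 by apply/eqP; rewrite eqn_leq n1 -ltnS n2.
rewrite (sum_ord_eq2 (fun i => co z i * co z i)) // [in n%:R]n_eq2.
move: zl; rewrite /space_coord n0 n1 ltnNge -ltnS n2 /= addr0.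
have := z_ge1 0%N n0; have := z_ge1 1%N n1.
have /intrP[p Ep] := center_like_half cz n0.
have /intrP[q Eq] := center_like_half cz n1.
have /intrP[r Er] := center_like_half_max cz.
have -> : co z 0 = (2 * p + 1)%:~R by rewrite intrD intrM -Ep; field.
have -> : co z 1 = (2 * q + 1)%:~R by rewrite intrD intrM -Eq; field.
have -> : co z n = (2 * r + 3)%:~R by rewrite intrD intrM -Er; field.
have -> : 2 - 9 = (-7)%:~R :> R by rewrite -[(-7)%:~R]/(- 7%:R : R); ring.
rewrite -[1 : R]/(1%:~R) -!intrM -!intrD -intrB !ler_int => q0 p0 le /intr_inj zz.
(* Parity sharpens [x_1 + x_2 <= x_3] by one, as the left side is even and the right side odd;
   comparing squares then forces [p = q = 0]. *)
have r_ge : p + q <= r by lia.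
by nia.
Qed.

Lemma center_like_cone y : center_like y ->
  (forall e, side_normal e -> lor y e <= 0) -> y = center.
Proof.
move=> cy ys; have [ev yy yf] := cy.
have [|A SA dA] := Sigma_fold n_range _ yf ys.
  by rewrite yy center_timelike.
have [gA Ac] := Sigma_Gamma n_range SA; have [lA [pA iA]] := gA.
have : A *m y = center.
  apply: center_like_Delta dA; split.
  (* [A] need not lie in [Gamma2], but it fixes [center], so [A y - center = A (y - center)]. *)
  - by rewrite -Ac -mulmxBr; exact: even_mulmx.
  - by rewrite lA.
  - by rewrite -coord_max; apply: pA; rewrite ?coord_max // yy center_timelike.
move=> Ay; rewrite -(adj_fix_center lA Ac) -Ay.
by rewrite mulmxA lor_adjK // mul1mx.
Qed.

Lemma evenD x y : even x -> even y -> even (x + y).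
Proof. by move=> ex ey i; rewrite mxE mulrDl rpredD. Qed.

Lemma center_like_mulmx A v : Gamma2 A -> center_like v -> center_like (A *m v).
Proof.
move=> gA [ev vv vf]; have [[lA [pA iA]] _] := gA; split.
- have -> : A *m v - center = A *m (v - center) + (A *m center - center).
    by rewrite mulmxBr addrA subrK.
  apply: evenD; first exact: even_mulmx.
  exact: Gamma2_even gA (@center_integral R n).
- by rewrite lA.
- by rewrite -coord_max; apply: pA; rewrite ?coord_max // vv center_timelike.
Qed.

Lemma center_like_center : center_like center.
Proof.
split; [by move=> i; rewrite subrr mxE mul0r rpred0 | by [] | exact: center_future].
Qed.

Lemma center_like_integral v : center_like v -> integral v.
Proof.
move=> [ev _ _] i; have /intrP[m Em] := ev i.
have -> : v i 0 = (m * 2)%:~R + (center : vec R n) i 0.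
  by rewrite intrM -Em !mxE; field.
by rewrite rpredD ?intr_int ?(@center_integral R n i).
Qed.

Lemma mulmx_refl_side e x : side_normal e -> refl e *m x = x - (2 * lor x e) *: e.
Proof. by move=> [_ e1 _]; rewrite mulmx_refl e1 divr1. Qed.

Lemma Gamma2_refl_side e : side_normal e -> Gamma2 (refl e).
Proof. by move=> [ie e1 _]; exact: Gamma2_refl. Qed.

(** Reflecting in a violated side lowers [- lor v center] by [2 * lor v e], where [lor v e] is a
    positive integer. The quantity stays positive, so the descent stops, and by [center_like_cone]
    it stops at [center]. *)
Lemma orbit_descent (P : vec R n -> Prop) : P center ->
  (forall v e, center_like v -> side_normal e -> 0 < lor v e ->
     P (refl e *m v) -> P v) ->
  forall v, center_like v -> P v.
Proof.
move=> Pc Pstep v cv.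
suff H (N : nat) : forall u, center_like u -> - lor u center <= N%:R -> P u.
  apply: (H (Num.bound (- lor v center))) => //; apply/ltW/archi_boundP.
  have [_ vv vf] := cv; rewrite oppr_ge0; apply/ltW/future_lor_lt0 => //.
  - by rewrite vv ltW // center_timelike.
  - exact: center_timelike.
  - exact: center_future.
elim: N => [|N IH] u cu uN; have [_ uu uf] := cu.
  have : lor u center < 0.
    apply: future_lor_lt0 => //; [|exact: center_timelike|exact: center_future].
    by rewrite uu ltW // center_timelike.
  by move: uN; rewrite oppr_le0 => /le_lt_trans h /h; rewrite ltxx.
have [us|] := pselect (forall e, side_normal e -> lor u e <= 0).
  by rewrite (center_like_cone cu us).
move=> /existsNP[e /not_implyP[se /negP]]; rewrite -ltNge => ue.
apply: (Pstep u e) => //; apply: IH.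
  exact: center_like_mulmx (Gamma2_refl_side se) cu.
have [ie _ ec] := se.
have : 1 <= lor u e.
  move: ue; have /intrP[m ->] := lor_int (center_like_integral cu) ie.
  by rewrite -[0]/(0%:~R) -[1]/(1%:~R) ltr_int ler_int; lia.
rewrite mulmx_refl_side // !lorL ec.
by move: uN; rewrite -natr1; lra.
Qed.

(** [C] preserves side normals and parity, so it fixes each [- e_k], hence all space coordinates;
    the product with [center] then recovers the height. *)
Lemma Gamma2_fix_center C : Gamma2 C -> C *m center = center -> C = 1.
Proof.
move=> gC Cc; have [[lC [pC iC]] _] := gC.
have Ce k : (k < n)%N -> C *m evec R n k.+1 = evec R n k.+1.
  move=> kn; apply: oppr_inj; rewrite -mulmxN.
  apply: (side_normal_even_evec n_range) => //.
    by apply: side_normal_mulmx => //; exact: side_normal_evec.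
  by have := Gamma2_even gC (integralN (@evec_integral R n k.+1)); rewrite opprK.
apply: mulmx_ext => x; rewrite mul1mx.
have xk k : (k < n)%N -> co (C *m x) k = co x k.
  by move=> kn; rewrite -!lor_evec // -{1}(Ce k kn) lC.
apply: coord_ext => k; rewrite leq_eqVlt => /orP[/eqP ->|]; last exact: xk.
have : lor (C *m x) center = lor x center by rewrite -{1}Cc lC.
rewrite !lor_center (eq_bigr (fun i : 'I_n => co x i)) => [|i _]; last exact: xk.
by move=> /addrI /oppr_inj /mulfI; apply.
Qed.

Lemma Gamma2_center_inj C : Gamma2 C -> C != 1 -> C *m center != center.
Proof. by move=> gC; apply: contra => /eqP /(Gamma2_fix_center gC) ->. Qed.

(* Hence the polytope is the Dirichlet domain of the center. *)
Lemma center_like_far x v : (forall e, side_normal e -> lor x e < 0) ->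
  center_like v -> v != center -> - lor x center < - lor x v.
Proof.
move=> xs; move: v; apply: orbit_descent => [|v e cv se ve IH _].
  by rewrite eqxx.
have {}IH : - lor x center <= - lor x (refl e *m v).
  by have [->//|/IH/ltW] := eqVneq (refl e *m v) center.
(* Undoing the reflection changes [- lor x _] by [- 2 * lor v e * lor x e > 0]. *)
apply: le_lt_trans IH _; rewrite mulmx_refl_side // !lorL.
have : lor v e * lor x e < 0 by rewrite pmulr_rlt0 // xs.
nra.
Qed.

(** Descent on the image of [center] strips reflections off an element of [Gamma2] until it fixes
    [center], and then it is 1. *)
Lemma Gamma2_gen : @Gamma2 R n = gen [set refl e | e in [set e | side_normal e]].
Proof.
have inv C : [set refl e | e in [set e | side_normal e]] C -> C * C = 1.
  by move=> [e [_ e1 _] <-]; apply: refl_involutive; rewrite e1 oner_neq0.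
apply/seteqP; split; last first.
  apply: (gen_involutive_ind inv) => [|_ A [e se <-] _]; first exact: Gamma2_1.
  exact/Gamma2_mul/Gamma2_refl_side.
move=> A gA.
suff H : forall v, center_like v -> forall B, Gamma2 B -> B *m center = v ->
    gen [set refl e | e in [set e | side_normal e]] B.
  exact: H (center_like_mulmx gA center_like_center) A gA erefl.
apply: orbit_descent => [B gB Bc|v e cv se ve IH B gB Bv].
  by rewrite (Gamma2_fix_center gB Bc); exact: gen1.
have gr : [set refl e | e in [set e | side_normal e]] (refl e) by exists e.
rewrite -[B]mul1r -(inv _ gr) -mulrA; apply: genM; first exact: gen_base.
apply: IH; first exact: Gamma2_mul (Gamma2_refl_side se) gB.
by rewrite -mulmxA Bv.
Qed.

End Descent.

(** * The polytope *)

Section Polytope.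
Variables (R : realType) (n : nat).
Hypothesis n_range : (2 <= n <= 7)%N.
Implicit Types (x y z v w e f : vec R n) (A B C : mat R n) (V : seq (vec R n)).

(* Otherwise moving [x] along the geodesic in direction [e] leaves [P]; the
   geodesic is parametrized rationally, by the half-angle [s]. *)
Lemma interior_lor_lt0 (P : set (vec R n)) x e :
  interiorH P x -> (forall y, P y -> lor y e <= 0) -> lor e e = 1 -> lor x e < 0.
Proof.
move=> [[xx xf] [eps [eps0 near]]] Pe e1; rewrite coord_max in xf.
have Px : P x.
  by apply: near => [|i]; [split; rewrite ?coord_max | rewrite subrr normr0].
rewrite lt_neqAle Pe // andbT; apply/eqP => xe.
set M := 1 + \sum_i (`|x i 0| + `|e i 0|).
have M_ge i : `|x i 0| + `|e i 0| <= M - 1.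
  rewrite /M [1 + _]addrC addrK (bigD1 i) //= lerDl.
  by apply: sumr_ge0 => j _; apply: addr_ge0.
have M1 : 1 <= M.
  by rewrite /M lerDl; apply: sumr_ge0 => j _; apply: addr_ge0.
have D0 : 0 < 4 * M + 2 * eps by lra.
(* The term [2 * eps] ensures [s <= 1/2], hence [a - 1, b <= 3 * s] below; the term [4 * M] keeps
   the displacement under [eps]. *)
set s := eps / (4 * M + 2 * eps).
have s0 : 0 < s by rewrite divr_gt0.
have Es : s * (4 * M + 2 * eps) = eps by rewrite divfK // gt_eqF.
have s2 : s <= 1 / 2 by rewrite ler_pdivrMr //; lra.
have sM : 4 * M * s < eps by rewrite -[ltRHS]Es; nra.
have q0 : 0 < 1 - s ^+ 2 by rewrite expr2; nra.
(* These are [cosh t] and [sinh t] for [s = tanh (t/2)]. *)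
pose a := (1 + s ^+ 2) / (1 - s ^+ 2); pose b := 2 * s / (1 - s ^+ 2).
have a1 : 0 <= a - 1 <= 3 * s.
  have -> : a - 1 = 2 * s ^+ 2 / (1 - s ^+ 2) by rewrite /a; field; rewrite gt_eqF.
  apply/andP; split; last by rewrite ler_pdivrMr // !expr2; nra.
  by apply: divr_ge0; [have := sqr_ge0 s; lra | exact: ltW].
have b1 : 0 < b <= 3 * s.
  apply/andP; split; last by rewrite ler_pdivrMr // !expr2; nra.
  by apply: divr_gt0 => //; lra.
have [/andP[a_ge a_le] /andP[b_gt b_le]] := (a1, b1).
have ab : a ^+ 2 - b ^+ 2 = 1 by rewrite /a /b; field; rewrite gt_eqF.
pose y := a *: x + b *: e.
have yy : lor y y = -1.
  by rewrite !lorL xx e1 (lorC e x) xe -[RHS]mulN1r -ab; ring.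
have yf : 0 < co y n.
  apply: (@lor_lt0_future _ _ y x) => //; rewrite ?yy ?xx ?lerN10 ?ltrN10 //.
  by rewrite !lorL xx (lorC e x) xe; lra.
have Py : P y.
  apply: near; first by split=> //; rewrite coord_max.
  move=> i; rewrite !mxE.
  have -> : a * x i 0 + b * e i 0 - x i 0 = (a - 1) * x i 0 + b * e i 0 by ring.
  apply: le_lt_trans (ler_normD _ _) _; rewrite (normrM (a - 1)) (normrM b).
  rewrite (ger0_norm a_ge) (gtr0_norm b_gt).
  have hx : (a - 1) * `|x i 0| <= 3 * s * `|x i 0| by apply: ler_wpM2r.
  have he : b * `|e i 0| <= 3 * s * `|e i 0| by apply: ler_wpM2r.
  have := M_ge i => Mi; have h : 3 * s * (`|x i 0| + `|e i 0|) <= 3 * s * (M - 1).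
    by apply: ler_wpM2l => //; lra.
  by nra.
by have := Pe _ Py; rewrite !lorL xe e1; lra.
Qed.

(** * The polytope as a convex hull *)

Lemma hull_sum V x (I : finType) (c : I -> R) (u : I -> vec R n) :
  Hn x -> (forall i, 0 <= c i) -> (forall i, u i \in V) ->
  x = \sum_i c i *: u i -> hull V x.
Proof.
move=> Hx c0 uV Ex; split=> //.
have idx i : (index (u i) V < size V)%N by rewrite index_mem.
(* The values of [u] may repeat; their coefficients are collected at the first position in [V]. *)
exists (fun j => \sum_(i | Ordinal (idx i) == j) c i); split.
  by move=> j; apply: sumr_ge0.
rewrite Ex (partition_big (fun i => Ordinal (idx i)) xpredT) //=.
apply: eq_bigr => j _; rewrite scaler_suml; apply: eq_bigr => i /eqP <-.
by rewrite /= nth_index.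
Qed.

(** The reverse Cauchy-Schwarz slope at [center] is [(9 - n) / 6 >= 1/3], so the height is at most
    [3 * 9]. *)
Lemma vertex_like_bounded v k : integral v -> lor v v <= 0 -> 0 < co v n ->
  - lor v center <= 9 -> (k <= n)%N -> `|co v k| <= 27%:R.
Proof.
move=> iv v0 vf vc kn; apply: le_trans (coord_causal_le v0 kn) _.
rewrite gtr0_norm //.
have := lor_causal_timelike v0 (ltW vf) (center_timelike R n_range) (center_future R n).
rewrite lor_center_center coord_center_max => H.
have n7 := (natr_range R n_range).2.
have : co v n * (1 / 3) <= co v n * (- (n%:R - 9) / (2 * 3)).
  by apply: ler_wpM2l; [exact: ltW | lra].
lra.
Qed.

(** The list holds all causal future vectors of the box satisfying the side inequalities, not just
    vertices. This makes one inclusion immediate; the other only needs the [Sigma]-images of the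
    simplex vertices to be in it. *)
Lemma Pn_hull : exists V : seq (vec R n),
  (forall v, v \in V -> lor v v <= 0 /\ 0 < v ord_max 0) /\ @Pn R n = hull V.
Proof.
have [L LP] := integral_box R n 27.
pose good v := [/\ lor v v <= 0, 0 < co v n & forall e, side_normal e -> lor v e <= 0].
exists [seq v <- L | `[< good v >]]; split.
  by move=> v; rewrite mem_filter coord_max => /andP[/asboolP[]].
have Sigma_good A v : Sigma A -> integral v -> lor v v <= 0 -> 0 < co v n ->
    - lor v center <= 9 -> (forall e, side_normal e -> lor v e <= 0) ->
    A *m v \in [seq v <- L | `[< good v >]].
  move=> SA iv v0 vf vc vs.
  have [gA Ac] := Sigma_Gamma n_range SA; have [lA [pA iA]] := gA.
  have Avc : lor (A *m v) center = lor v center by rewrite -{1}Ac lA.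
  have Af : 0 < co (A *m v) n.
    apply: (lor_lt0_future _ (center_timelike R n_range) (center_future R n)).
      by rewrite lA.
    rewrite Avc; apply: future_lor_lt0 => //; [exact: center_timelike|exact: center_future].
  rewrite mem_filter; apply/andP; split.
    apply/asboolP; split=> //; first by rewrite lA.
    move=> e se; rewrite lor_adjP; apply: vs; apply: side_normal_mulmx => //.
      exact: Gamma_adj.
    exact: adj_fix_center.
  apply: LP => [|k kn]; first exact: integral_mulmx.
  by apply: vertex_like_bounded => //; [exact: integral_mulmx|rewrite lA|rewrite Avc].
apply/seteqP; split=> x; last first.
  move=> [Hx [c [c0 Ex]]]; apply/(PnP n_range); split=> // e se.
  rewrite Ex lor_suml; apply: sumr_le0 => i _; rewrite lorZl.
  apply: mulr_ge0_le0 => //.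
  have := mem_nth 0 (ltn_ord i); rewrite mem_filter => /andP[/asboolP[_ _ vs] _].
  exact: vs.
move=> Px; have [Hx _] := (PnP n_range x).1 Px.
have [A [SA [d [/(Delta_coneP n_range)[_ dd] Exd]]]] := Px.
have [le dl] := dd.
pose c (k : 'I_n.+1) : R := if (k < n)%N then space_coord d k - space_coord d k.+1
  else co d n - (space_coord d 0 + space_coord d 1 + space_coord d 2).
pose u (k : 'I_n.+1) : vec R n :=
  if (k < n)%N then vertex R n k.+1 else evec R n n.+1.
apply: (@hull_sum _ _ _ c (fun k => A *m u k)) => //.
- by move=> k; rewrite /c; case: ifP => _; rewrite subr_ge0.
- move=> k; rewrite /u; case: ifP => kn.
    have [iv v0 vf vc] := @vertex_causal R n n_range k.+1 kn.
    by apply: Sigma_good => // e se; exact: vertex_side_le0.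
  apply: Sigma_good => //.
  + exact: evec_integral.
  + by rewrite lor_evec_max_max lerN10.
  + by rewrite coord_evec // eqxx.
  + by rewrite lor_evec_max_center; lra.
  + by move=> e se; exact: evec_max_side_le0.
rewrite big_ord_recr /= /c /u ltnn Exd {1}(vertex_decomposition d) mulmxDr mulmx_sumr.
rewrite -scalemxAr; congr (_ + _); apply: eq_bigr => k _.
by rewrite /= ltn_ord -scalemxAr.
Qed.

Lemma Hn_timelike x : Hn x -> lor x x < 0 /\ 0 < co x n.
Proof. by move=> [xx xf]; rewrite xx ltrN10 -coord_max. Qed.

Lemma Pn_polytope (E : seq (vec R n)) : (forall e, e \in E <-> side_normal e) ->
  polytope_with_sides (@Pn R n) E.
Proof.
move=> EP; split.
- by move=> e /EP[].
- apply/seteqP; split=> x.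
    by move=> /(PnP n_range)[Hx xs]; split=> // e /EP; exact: xs.
  by move=> [Hx xs]; apply/(PnP n_range); split=> // e /EP; exact: xs.
- have [s s0 Hs] := timelike_normalize (center_timelike R n_range) (center_future R n).
  exists (s *: center); split=> // e /EP[_ _ ec].
  by rewrite lorZl lorC ec mulrN1 oppr_lt0.
- move=> e /EP se; have [ct cf] := center_add_side_future n_range se.
  have [s s0 Hs] := timelike_normalize ct cf.
  have [_ e1 ec] := se.
  have val f : side_normal f -> lor (s *: (center + e)) f = s * (lor e f - 1).
    by move=> [_ _ fc]; rewrite !lorL (lorC center f) fc addrC.
  have neg f : side_normal f -> f != e -> lor (s *: (center + e)) f < 0.
    move=> sf fe; rewrite val // pmulr_rlt0 //.
    by have := side_normal_lor_le0 n_range se sf; rewrite eq_sym fe => /(_ isT); lra.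
  have zer : lor (s *: (center + e)) e = 0 by rewrite val // e1 subrr mulr0.
  exists (s *: (center + e)); split; [apply/(PnP n_range); split=> // f sf | split=> //].
    by have [->|fe] := eqVneq f e; [rewrite zer | apply/ltW/neg].
  by move=> f /EP; exact: neg.
- exact: Pn_hull.
Qed.

Lemma side_normals_right_angled (E : seq (vec R n)) :
  (forall e, e \in E <-> side_normal e) -> right_angled E.
Proof.
move=> EP e f /EP se /EP sf ef [p [pp [pf [_ [pe [pf' _]]]]]].
have [ie e1 _] := se; have [jf f1 _] := sf.
have ef0 := side_normal_lor_le0 n_range se sf ef.
have ef_ge : -1 <= lor e f.
  rewrite leNgt; apply/negP => lt.
  have ut : lor (e + f) (e + f) < 0 by rewrite !lorL e1 f1 (lorC f e); lra.
  have pn0 : p != 0.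
    by apply: contraTneq pf => ->; rewrite mxE ltxx.
  have := lor_orthogonal_timelike_gt0 ut _ pn0.
  by rewrite lorDr pe pf' addr0 => /(_ erefl); rewrite ltNge pp.
rewrite /dihedral_angle; move: ef0 ef_ge.
have /intrP[m ->] := lor_int ie jf.
rewrite -[0]/(0%:~R) -[-1]/((-1)%:~R) !ler_int => m0 m1.
have [->|->] : m = -1 \/ m = 0 by lia.
  by left; rewrite -[(-1)%:~R]/(-1 : R) opprK acos1.
by right; rewrite oppr0 acos0.
Qed.

(** If [x] and [A x] were both interior, [x] would be closer to [center] than to its preimage under
    [A], and [A x] closer to [center] than to [A center]; as [A] is an isometry these contradict
    each other. For covering, the orbit point closest to [center] violates no side. *)
Lemma Pn_fundamental : fundamental_polytope (@Gamma2 R n) (@Pn R n).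
Proof.
have interior_lt x : interiorH (@Pn R n) x -> forall e, side_normal e -> lor x e < 0.
  move=> ix e se; apply: (interior_lor_lt0 ix); last by case: se.
  by move=> y /(PnP n_range)[_]; apply.
split.
  move=> A gA A1 x /interior_lt xs /interior_lt Axs.
  have [[lA _] _] := gA; have gA' := Gamma2_adj gA.
  have A'1 : lor_adj A != 1.
    apply: contra A1 => /eqP E; apply/eqP.
    by have := lor_adjVK lA; rewrite E mulmx1.
  have far v := center_like_far n_range xs (v := v).
  have farA v := center_like_far n_range Axs (v := v).
  have cl B : Gamma2 B -> center_like (B *m center).
    by move=> gB; exact: center_like_mulmx gB (center_like_center R n).
  have h1 := far _ (cl _ gA') (Gamma2_center_inj n_range gA' A'1).
  have h2 := farA _ (cl _ gA) (Gamma2_center_inj n_range gA A1).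
  move: h1 h2; rewrite lA -lor_adjP => h1 h2.
  by have := lt_trans h1 h2; rewrite ltxx.
move=> y Hy; have [yt yf] := Hn_timelike Hy.
have [A gA Amin] : exists2 A, Gamma2 A & forall B, Gamma2 B ->
    - lor (A *m y) center <= - lor (B *m y) center.
  apply: Gamma_orbit_argmin => //.
  - by move=> B [].
  - by exists 1; exact: Gamma2_1.
  - exact: center_integral.
  - exact: center_timelike.
  - exact: center_future.
have [[lA [pA _]] _] := gA.
exists (lor_adj A); split; first exact: Gamma2_adj.
exists (A *m y); split; last by rewrite mulmxA lor_adjK // mul1mx.
apply/(PnP n_range); split.
  by have [yy ym] := Hy; split; [rewrite lA|exact: pA].
move=> e se; have [_ _ ec] := se.
have := Amin _ (Gamma2_mul (Gamma2_refl_side se) gA).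
rewrite -mulmxA mulmx_refl_side // !lorL ec.
by move: (lor (A *m y) _) (lor (A *m y) e) => s t; lra.
Qed.

End Polytope.

Theorem theorem2p1 (R : realType) (n : nat) :
  (2 <= n <= 7)%N ->
  exists E : seq (vec R n),
    [/\ polytope_with_sides (@Pn R n) E,
        right_angled E,
        fundamental_polytope (@Gamma2 R n) (@Pn R n)
      & @Gamma2 R n = gen [set refl e | e in [set e | e \in E]]].
Proof.
move=> n_range; have [E EP] := side_normal_finite R n_range.
exists E; split.
- exact: Pn_polytope.
- exact: side_normals_right_angled.
- exact: Pn_fundamental.
rewrite (Gamma2_gen R n_range); congr (gen [set refl e | e in _]).
by apply/seteqP; split=> e /EP.
Qed.
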